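(* There is a Turing ideal $\mathcal{I} \subseteq \mathcal{P}(\omega)$ such that the $\omega$-model $(\omega, \mathcal{I})$ satisfies $\mathsf{ADS}$ but not $\mathsf{SCAC}$. Therefore, $\mathsf{ADS}$ does not imply $\mathsf{SCAC}$ (over $\mathsf{RCA}_0$).
   Context: A Turing ideal is a nonempty collection of subsets of $\omega$ closed under Turing reducibility and join; $(\omega,\mathcal{I})$ is the $\omega$-model of second order arithmetic with second order part $\mathcal{I}$ (a model of $\mathsf{RCA}_0$). Infinite structures have domain $\mathbb{N}$. $\mathsf{ADS}$: for every infinite linear order $L=(\mathbb{N},<_L)$ there is a function $f:\mathbb{N}\to\mathbb{N}$ which is either an infinite ascending sequence in $L$ (for all $n<m$, $f(n)<_L f(m)$) or an infinite descending sequence in $L$ (for all $n<m$, $f(n)>_L f(m)$). For an infinite poset $M=(\mathbb{N},\preceq_M)$, write $x\,|_M\,y$ if $x,y$ are incomparable, i.e. $x\not\preceq_M y$ and $y\not\preceq_M x$. A set $S$ is a chain if any two of its elements are comparable, and an antichain if any two distinct elements are incomparable. Let $A^*(M)=\{n\mid \exists x\,\forall y>x\,(n\preceq_M y)\}$, $B^*(M)=\{n\mid \exists x\,\forall y>x\,(n\,|_M\,y)\}$, $C^*(M)=\{n\mid \exists x\,\forall y>x\,(y\preceq_M n)\}$ (here $>$ is the usual order on $\mathbb{N}$). $M$ is stable if $A^*(M)\cup B^*(M)=\mathbb{N}$ or $C^*(M)\cup B^*(M)=\mathbb{N}$. $\mathsf{SCAC}$: every infinite stable poset $M$ contains either an infinite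 chain or an infinite antichain. *)

(* Defs.v *)
From mathcomp Require Import all_boot.
From mathcomp Require Import classical_sets.
From Stdlib Require List.

Set Implicit Arguments.
Unset Strict Implicit.
Unset Printing Implicit Defensive.

Local Open Scope classical_set_scope.

(** * Turing reducibility and Turing ideals *)

(** Kleene's schemes for the functions partial recursive in an oracle. *)
Inductive code : Type :=
| CZero
| CSucc
| CProj of nat
| COracle
| CComp of code & seq code
| CPrec of code & code
| CMu of code.

Definition chi (A : set nat) (n : nat) : nat := n \in A.

(** [eval A c v y]: the program [c] with oracle [A] halts on input [v] with
    output [y].  In [eval_mu] the function [w] only records that [c] converges
    to a nonzero value at every [z < y]. *)
Inductive eval (A : set nat) : code -> seq nat -> nat -> Prop :=
| eval_zero v : eval A CZero v 0
| eval_succ x : eval A CSucc [:: x] x.+1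
| eval_proj i v : i < size v -> eval A (CProj i) v (nth 0 v i)
| eval_oracle x : eval A COracle [:: x] (chi A x)
| eval_comp c cs v w y :
    evals A cs v w -> eval A c w y -> eval A (CComp c cs) v y
| eval_prec0 c d v y : eval A c v y -> eval A (CPrec c d) (0 :: v) y
| eval_precS c d k v z y :
    eval A (CPrec c d) (k :: v) z -> eval A d [:: k, z & v] y ->
    eval A (CPrec c d) (k.+1 :: v) y
| eval_mu c v y (w : nat -> nat) :
    (forall z, z < y -> eval A c (z :: v) (w z).+1) ->
    eval A c (y :: v) 0 -> eval A (CMu c) v y
with evals (A : set nat) : seq code -> seq nat -> seq nat -> Prop :=
| evals_nil v : evals A [::] v [::]
| evals_cons c cs v y w :
    eval A c v y -> evals A cs v w -> evals A (c :: cs) v (y :: w).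

Definition turing_le (X Y : set nat) : Prop :=
  exists c : code, forall n, eval Y c [:: n] (chi X n).

Definition turing_join (X Y : set nat) : set nat :=
  [set n.*2 | n in X] `|` [set n.*2.+1 | n in Y].

Definition turing_ideal (I : set (set nat)) : Prop :=
  [/\ I !=set0,
      forall X Y, I Y -> turing_le X Y -> I X &
      forall X Y, I X -> I Y -> I (turing_join X Y)].

(** * The language of second order arithmetic *)

(** Number variables and set variables are two independent families of
    de Bruijn indices: a number (resp. set) quantifier binds the number
    (resp. set) variable 0.  Equality of sets is not primitive. *)
Inductive term : Type :=
| Var of nat
| Zero
| One
| Add of term & term
| Mul of term & term.

Inductive form : Type :=
| Bot
| Eq of term & term
| Lt of term & term
| Member of term & nat
| Imp of form & form
| And of form & form
| Or of form & form
| AllN of form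
| ExN of form
| AllS of form
| ExS of form.

Declare Scope L2_scope.
Delimit Scope L2_scope with L2.
Bind Scope L2_scope with term form.
Notation "0" := Zero : L2_scope.
Notation "1" := One : L2_scope.
Notation "s + t" := (Add s t) : L2_scope.
Notation "s * t" := (Mul s t) : L2_scope.
Notation "s == t" := (Eq s t) : L2_scope.
Notation "s < t" := (Lt s t) : L2_scope.
Notation "t \in X" := (Member t X) : L2_scope.
Notation "p -> q" := (Imp p q) : L2_scope.
Notation "p /\ q" := (And p q) : L2_scope.
Notation "p \/ q" := (Or p q) : L2_scope.
Notation "~ p" := (Imp p Bot) : L2_scope.
Notation "p <-> q" := (And (Imp p q) (Imp q p)) : L2_scope.

(** ** Simultaneous substitution *)

Definition scons (T : Type) (a : T) (s : nat -> T) (i : nat) : T :=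
  if i is j.+1 then s j else a.

Fixpoint tsubst (s : nat -> term) (t : term) : term :=
  match t with
  | Var i => s i
  | Zero => Zero
  | One => One
  | Add t u => Add (tsubst s t) (tsubst s u)
  | Mul t u => Mul (tsubst s t) (tsubst s u)
  end.

Definition tshift : term -> term := tsubst (fun i => Var i.+1).

Fixpoint subst (s : nat -> term) (r : nat -> nat) (p : form) : form :=
  match p with
  | Bot => Bot
  | Eq t u => Eq (tsubst s t) (tsubst s u)
  | Lt t u => Lt (tsubst s t) (tsubst s u)
  | Member t X => Member (tsubst s t) (r X)
  | Imp p q => Imp (subst s r p) (subst s r q)
  | And p q => And (subst s r p) (subst s r q)
  | Or p q => Or (subst s r p) (subst s r q)
  | AllN p => AllN (subst (scons (Var 0) (fun i => tshift (s i))) r p)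
  | ExN p => ExN (subst (scons (Var 0) (fun i => tshift (s i))) r p)
  | AllS p => AllS (subst s (scons 0 (fun i => (r i).+1)) p)
  | ExS p => ExS (subst s (scons 0 (fun i => (r i).+1)) p)
  end.

Definition shiftN : form -> form := subst (fun i => Var i.+1) id.
Definition shiftS : form -> form := subst Var S.
Definition instN (t : term) : form -> form := subst (scons t Var) id.
Definition instS (X : nat) : form -> form := subst Var (scons X id).

(** ** Provability (classical two-sorted natural deduction) *)

(** Axioms taken from [T] may have free variables and then stand for their
    universal closures: [T], unlike the context, is not shifted by the
    quantifier rules. *)
Inductive proves (T : form -> Prop) : seq form -> form -> Prop :=
| pr_ax G p : T p -> proves T G p
| pr_hyp G p : List.In p G -> proves T G p
| pr_raa G p : proves T (Imp p Bot :: G) Bot -> proves T G p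
| pr_impI G p q : proves T (p :: G) q -> proves T G (Imp p q)
| pr_impE G p q : proves T G (Imp p q) -> proves T G p -> proves T G q
| pr_andI G p q : proves T G p -> proves T G q -> proves T G (And p q)
| pr_andE1 G p q : proves T G (And p q) -> proves T G p
| pr_andE2 G p q : proves T G (And p q) -> proves T G q
| pr_orI1 G p q : proves T G p -> proves T G (Or p q)
| pr_orI2 G p q : proves T G q -> proves T G (Or p q)
| pr_orE G p q c :
    proves T G (Or p q) -> proves T (p :: G) c -> proves T (q :: G) c ->
    proves T G c
| pr_allNI G p : proves T (map shiftN G) p -> proves T G (AllN p)
| pr_allNE G p t : proves T G (AllN p) -> proves T G (instN t p)
| pr_exNI G p t : proves T G (instN t p) -> proves T G (ExN p)
| pr_exNE G p c :
    proves T G (ExN p) -> proves T (p :: map shiftN G) (shiftN c) ->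
    proves T G c
| pr_allSI G p : proves T (map shiftS G) p -> proves T G (AllS p)
| pr_allSE G p X : proves T G (AllS p) -> proves T G (instS X p)
| pr_exSI G p X : proves T G (instS X p) -> proves T G (ExS p)
| pr_exSE G p c :
    proves T G (ExS p) -> proves T (p :: map shiftS G) (shiftS c) ->
    proves T G c
| pr_eq_refl G t : proves T G (Eq t t)
| pr_eq_subst G t u p :
    proves T G (Eq t u) -> proves T G (instN t p) -> proves T G (instN u p).

(** ** omega-models *)

Fixpoint teval (e : nat -> nat) (t : term) : nat :=
  match t with
  | Var i => e i
  | Zero => 0
  | One => 1
  | Add t u => teval e t + teval e u
  | Mul t u => teval e t * teval e u
  end.

Fixpoint sat (I : set (set nat)) (e : nat -> nat) (E : nat -> set nat)
    (p : form) : Prop :=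
  match p with
  | Bot => False
  | Eq t u => teval e t = teval e u
  | Lt t u => teval e t < teval e u
  | Member t X => E X (teval e t)
  | Imp p q => sat I e E p -> sat I e E q
  | And p q => sat I e E p /\ sat I e E q
  | Or p q => sat I e E p \/ sat I e E q
  | AllN p => forall n, sat I (scons n e) E p
  | ExN p => exists n, sat I (scons n e) E p
  | AllS p => forall X, I X -> sat I e (scons X E) p
  | ExS p => exists2 X, I X & sat I e (scons X E) p
  end.

Definition omega_sat (I : set (set nat)) (p : form) : Prop :=
  forall e E, (forall i, I (E i)) -> sat I e E p.

(** * RCA_0 *)

Inductive bounded : form -> Prop :=
| bd_bot : bounded Bot
| bd_eq t u : bounded (Eq t u)
| bd_lt t u : bounded (Lt t u)
| bd_mem t X : bounded (Member t X)
| bd_imp p q : bounded p -> bounded q -> bounded (Imp p q)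
| bd_and p q : bounded p -> bounded q -> bounded (And p q)
| bd_or p q : bounded p -> bounded q -> bounded (Or p q)
| bd_all t p : bounded p -> bounded (AllN (Imp (Lt (Var 0) (tshift t)) p))
| bd_ex t p : bounded p -> bounded (ExN (And (Lt (Var 0) (tshift t)) p)).

Definition Sigma01 (p : form) : Prop := exists2 q, bounded q & p = ExN q.
Definition Pi01 (p : form) : Prop := exists2 q, bounded q & p = AllN q.

(** [p(0) /\ forall n (p(n) -> p(n+1)) -> forall n p(n)], with [n] the number
    variable 0 of [p]. *)
Definition induction (p : form) : form :=
  ((instN 0 p /\
    AllN (p -> subst (scons (Var 0 + 1) (fun i => Var i.+1)) id p))
   -> AllN p)%L2.

(** [shiftS] keeps the comprehended set from occurring in [p]. *)
Definition delta_comprehension (p q : form) : form :=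
  (AllN (p <-> q) -> ExS (AllN (Var 0 \in 0%N <-> shiftS p)))%L2.

Inductive RCA0 : form -> Prop :=
| rca_succ_neq0 : RCA0 (~ (Var 0 + 1 == 0))
| rca_succ_inj : RCA0 (Var 0 + 1 == Var 1 + 1 -> Var 0 == Var 1)
| rca_add0 : RCA0 (Var 0 + 0 == Var 0)
| rca_addS : RCA0 (Var 0 + (Var 1 + 1) == (Var 0 + Var 1) + 1)
| rca_mul0 : RCA0 (Var 0 * 0 == 0)
| rca_mulS : RCA0 (Var 0 * (Var 1 + 1) == Var 0 * Var 1 + Var 0)
| rca_lt0 : RCA0 (~ (Var 0 < 0))
| rca_ltS : RCA0 (Var 0 < Var 1 + 1 <-> Var 0 < Var 1 \/ Var 0 == Var 1)
| rca_ind p : Sigma01 p -> RCA0 (induction p)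
| rca_ca p q : Sigma01 p -> Pi01 q -> RCA0 (delta_comprehension p q).

(** * ADS and SCAC *)

(** In this part [L], [M], [f], [S] are (indices of) set variables; the
    formulas built from them have no free number variable, so that the indices
    of number variables are local to each definition. *)

(** A binary relation is represented by a set through the injective pairing
    [(s, t) |-> (s + t)^2 + s]; elements that code no pair are ignored. *)
Definition InRel (s t : term) (R : nat) : form :=
  ((s + t) * (s + t) + s \in R)%L2.

Definition LinearOrder (L : nat) : form :=
  let x := Var 0 in let y := Var 1 in let z := Var 2 in
  (AllN (~ InRel x x L) /\
   AllN (AllN (AllN (InRel x y L /\ InRel y z L -> InRel x z L))) /\
   AllN (AllN (x == y \/ InRel x y L \/ InRel y x L)))%L2.

Definition Function (f : nat) : form :=
  (AllN (ExN (InRel (Var 1) (Var 0) f)) /\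
   let x := Var 0 in let y := Var 1 in let z := Var 2 in
   AllN (AllN (AllN (InRel x y f /\ InRel x z f -> y == z))))%L2.

Definition Ascending (L f : nat) : form :=
  let n := Var 0 in let m := Var 1 in let a := Var 2 in let b := Var 3 in
  AllN (AllN (AllN (AllN
    (n < m /\ InRel n a f /\ InRel m b f -> InRel a b L))))%L2.

Definition Descending (L f : nat) : form :=
  let n := Var 0 in let m := Var 1 in let a := Var 2 in let b := Var 3 in
  AllN (AllN (AllN (AllN
    (n < m /\ InRel n a f /\ InRel m b f -> InRel b a L))))%L2.

Definition ADS : form :=
  AllS (LinearOrder 0 ->
    ExS (Function 0 /\ (Ascending 1 0 \/ Descending 1 0)))%L2.

Definition PartialOrder (M : nat) : form :=
  let x := Var 0 in let y := Var 1 in let z := Var 2 in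
  (AllN (InRel x x M) /\
   AllN (AllN (InRel x y M /\ InRel y x M -> x == y)) /\
   AllN (AllN (AllN (InRel x y M /\ InRel y z M -> InRel x z M))))%L2.

Definition Incomparable (x y : term) (M : nat) : form :=
  (~ InRel x y M /\ ~ InRel y x M)%L2.

(** Membership of the number variable 0 in [A^*(M)], [B^*(M)], [C^*(M)]. *)
Definition InAstar (M : nat) : form :=
  let n := Var 2 in let x := Var 1 in let y := Var 0 in
  ExN (AllN (x < y -> InRel n y M))%L2.

Definition InBstar (M : nat) : form :=
  let n := Var 2 in let x := Var 1 in let y := Var 0 in
  ExN (AllN (x < y -> Incomparable n y M))%L2.

Definition InCstar (M : nat) : form :=
  let n := Var 2 in let x := Var 1 in let y := Var 0 in
  ExN (AllN (x < y -> InRel y n M))%L2.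

Definition Stable (M : nat) : form :=
  (AllN (InAstar M \/ InBstar M) \/ AllN (InCstar M \/ InBstar M))%L2.

Definition Infinite (S : nat) : form :=
  AllN (ExN (Var 1 < Var 0 /\ Var 0 \in S))%L2.

Definition Chain (M S : nat) : form :=
  let x := Var 0 in let y := Var 1 in
  AllN (AllN (x \in S /\ y \in S -> InRel x y M \/ InRel y x M))%L2.

Definition Antichain (M S : nat) : form :=
  let x := Var 0 in let y := Var 1 in
  AllN (AllN
    (x \in S /\ y \in S /\ ~ (x == y) -> Incomparable x y M))%L2.

Definition SCAC : form :=
  AllS (PartialOrder 0 /\ Stable 0 ->
    ExS (Infinite 0 /\ (Chain 1 0 \/ Antichain 1 0)))%L2.

(* Main.v *)
Require Import Defs.
From HB Require Import structures.
From mathcomp Require Import all_boot classical_sets boolp zify.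
From Stdlib Require List.

(** An infinite chain of a stable poset [M] lies in [A*] and an infinite
    antichain in [B*].  The invariant kept along the ideal is Patey's dependent
    hyperimmunity of the pair: whenever a Sigma^0_1(X) relation [P(U,V)] is
    essential (there are arbitrarily high [U] such that for arbitrarily high
    [V], [P(U,V)]), it holds of some [U] inside [A*] and [V] inside [B*].  So
    [X] computes neither an infinite subset of [A*] nor one of [B*].

    A generic [M] whose order refines that of [nat] has the property for
    [X = M]: a pair of new sets [U < V] satisfying [P] can still be labelled
    [A] and [B], as no element of [V] lies below one of [U].

    For ADS, build an ascending sequence from below and a descending one from
    above, keeping infinitely many elements of [L] between them.  If the
    relation "some longer ascending and descending sequences force [P] and
    [P'] at [(U,V)]" is essential, invariance under [X] gives such extensions
    meeting both requirements, and one of the two can be kept.  If it is not,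
    then [P] and [P'] cannot both be essential relative to the final
    sequences.  Hence one of the sequences preserves the invariant.

    Sigma^0_1 relations are replaced by a countable family of continuous
    relations containing the computable instances needed and closed under the
    operation just described, so that no universal machine is required. *)

Set Implicit Arguments.
Unset Strict Implicit.
Unset Printing Implicit Defensive.

(** * Pairing of numbers and characteristic functions *)

Definition pairc (x y : nat) : nat := (x + y) * (x + y) + x.

(** With [s = x + y] the code lies between [s^2] and [s^2 + s], strictly below [(s + 1)^2], so it
    determines [s] and then [x]. *)
Lemma pairc_inj x y x' y' : pairc x y = pairc x' y' -> x = x' /\ y = y'.
Proof.
rewrite /pairc => h.
have e : x + y = x' + y'.
  have [h1|h1|//] := ltngtP (x + y) (x' + y'); nia.
by rewrite e in h; lia.
Qed.

Lemma pairc_gel x y : x <= pairc x y. Proof. by rewrite /pairc; nia. Qed.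
Lemma pairc_ger x y : y <= pairc x y. Proof. by rewrite /pairc; nia. Qed.

Lemma chi1 (A : set nat) n : A n -> chi A n = 1.
Proof. by move=> h; rewrite /chi mem_set. Qed.

Lemma chi_eq1 (A : set nat) n : chi A n = 1 <-> A n.
Proof. by split=> [|/chi1//]; rewrite /chi; case: (boolP (n \in A)) => // /set_mem. Qed.

(** * Local properties of sets *)

Definition agree (u : nat) (X Y : set nat) : Prop :=
  forall n, n < u -> (X n <-> Y n).

Lemma agreeW u v X Y : u <= v -> agree v X Y -> agree u X Y.
Proof. by move=> uv h n nu; apply: h; apply: leq_trans uv. Qed.

Lemma agree_sym u X Y : agree u X Y -> agree u Y X.
Proof. by move=> h n /h [a b]; split. Qed.

Lemma agree_trans u X Y Z : agree u X Y -> agree u Y Z -> agree u X Z.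
Proof. by move=> h1 h2 n nu; rewrite (h1 n nu); exact: h2. Qed.

Lemma agree_chi u X Y n : agree u X Y -> n < u -> chi X n = chi Y n.
Proof.
move=> h nu; rewrite /chi; congr nat_of_bool.
by apply/idP/idP => /set_mem /(h n nu) /mem_set.
Qed.

(** [X] is an interior point of [P] in Cantor space: a finite part of the oracle suffices. *)
Definition local (P : set nat -> Prop) (X : set nat) : Prop :=
  exists u, forall Y, agree u X Y -> P Y.

Lemma local_imp (P Q : set nat -> Prop) X :
  (forall Y, P Y -> Q Y) -> local P X -> local Q X.
Proof. by move=> PQ [u h]; exists u => Y /h /PQ. Qed.

Lemma local_and (P Q : set nat -> Prop) X :
  local P X -> local Q X -> local (fun Y => P Y /\ Q Y) X.
Proof.
move=> [u hu] [v hv]; exists (maxn u v) => Y h.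
by split; [apply: hu|apply: hv]; apply: agreeW h; rewrite ?leq_maxl ?leq_maxr.
Qed.

Lemma local_all (T : eqType) (P : T -> set nat -> Prop) (s : seq T) X :
  (forall x, x \in s -> local (P x) X) ->
  local (fun Y => forall x, x \in s -> P x Y) X.
Proof.
elim: s => [|a s IH] h; first by exists 0.
have h1 : local (P a) X by apply: h; rewrite mem_head.
have h2 := IH (fun x xs => h x (mem_behead (s := a :: s) xs)).
apply: local_imp (local_and h1 h2) => Y [pa ps] x.
by rewrite inE => /orP[/eqP ->|/ps].
Qed.

(** * Kleene's schemes *)

Scheme eval_mut := Minimality for eval Sort Prop
  with evals_mut := Minimality for evals Sort Prop.
Combined Scheme eval_evals_ind from eval_mut, evals_mut.

(** The use principle: a halting computation has a finite derivation, hence makes finitely many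
    oracle queries. *)
Lemma eval_use A c v y : eval A c v y -> local (fun B => eval B c v y) A.
Proof.
move: c v y.
suff [//] : (forall c v y, eval A c v y -> local (fun B => eval B c v y) A) /\
  (forall cs v w, evals A cs v w -> local (fun B => evals B cs v w) A).
apply: eval_evals_ind.
- by move=> v; exists 0 => B _; constructor.
- by move=> x; exists 0 => B _; constructor.
- by move=> i v iv; exists 0 => B _; constructor.
- move=> x; exists x.+1 => B h.
  by rewrite (agree_chi h (ltnSn x)); constructor.
- move=> c cs v w y _ l1 _ l2.
  by apply: local_imp (local_and l1 l2) => B [e1 e2]; apply: eval_comp e1 e2.
- by move=> c d v y _; apply: local_imp => B; constructor.
- move=> c d k v z y _ l1 _ l2.
  by apply: local_imp (local_and l1 l2) => B [e1 e2]; apply: eval_precS e1 e2.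
- move=> c v y w _ l1 _ l2.
  (* The search passes through the finitely many arguments below [y], so the uses of these runs have
     a common bound. *)
  have l3 : local (fun B => forall z, z \in iota 0 y ->
      eval B c (z :: v) (w z).+1) A.
    by apply: local_all => z; rewrite mem_iota => /l1.
  apply: local_imp (local_and l2 l3) => B [e1 e2]; apply: (eval_mu (w := w)) => //.
  by move=> z zy; apply: e2; rewrite mem_iota.
- by move=> v; exists 0 => B _; constructor.
- move=> c cs v y w _ l1 _ l2.
  by apply: local_imp (local_and l1 l2) => B [e1 e2]; constructor.
Qed.

Lemma eval_det A c v y y' : eval A c v y -> eval A c v y' -> y = y'.
Proof.
move=> h; move: c v y h y'.
suff [//] : (forall c v y, eval A c v y -> forall y', eval A c v y' -> y = y') /\
  (forall cs v w, evals A cs v w -> forall w', evals A cs v w' -> w = w').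
apply: eval_evals_ind.
- by move=> v y' h; inversion h.
- by move=> x y' h; inversion h.
- by move=> i v iv y' h; inversion h.
- by move=> x y' h; inversion h.
- move=> c cs v w y _ IH1 _ IH2 y' h; inversion h as [| | | |? ? ? w' ? e1 e2| | |]; subst.
  by apply: IH2; rewrite (IH1 _ e1).
- by move=> c d v y _ IH y' h; inversion h; subst; apply: IH.
- move=> c d k v z y _ IH1 _ IH2 y' h; inversion h as [| | | | | |? ? ? ? z' ? e1 e2|]; subst.
  by apply: IH2; rewrite (IH1 _ e1).
- move=> c v y w _ IH1 _ IH2 y' h; inversion h as [| | | | | | |? ? ? w' e1 e2]; subst.
  have [lt|lt|//] := ltngtP y y'.
    by have := IH2 _ (e1 _ lt).
  by have := IH1 _ lt _ e2.
- by move=> v w' h; inversion h.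
- move=> c cs v y w _ IH1 _ IH2 w' h; inversion h as [|? ? ? ? ? e1 e2]; subst.
  by rewrite (IH1 _ e1) (IH2 _ e2).
Qed.

Fixpoint code_subst (d c : code) : code :=
  match c with
  | COracle => d
  | CComp c cs => CComp (code_subst d c) (map (code_subst d) cs)
  | CPrec c e => CPrec (code_subst d c) (code_subst d e)
  | CMu c => CMu (code_subst d c)
  | c => c
  end.

Lemma eval_subst X Y d c v y :
  (forall n, eval Y d [:: n] (chi X n)) ->
  eval X c v y -> eval Y (code_subst d c) v y.
Proof.
move=> hd; move: c v y.
suff [//] : (forall c v y, eval X c v y -> eval Y (code_subst d c) v y) /\
  (forall cs v w, evals X cs v w -> evals Y (map (code_subst d) cs) v w).
apply: eval_evals_ind => /=; try by [constructor|move=> *; constructor].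
- by move=> x; exact: hd.
- by move=> c cs v w y _ l1 _ l2; apply: eval_comp l1 l2.
- by move=> c e k v z y _ l1 _ l2; apply: eval_precS l1 l2.
- by move=> c v y w _ l1 _ l2; apply: (eval_mu (w := w)).
Qed.

Lemma turing_le_refl X : turing_le X X.
Proof. by exists COracle => n; constructor. Qed.

Lemma turing_le_trans Y X Z : turing_le X Y -> turing_le Y Z -> turing_le X Z.
Proof.
by move=> [c hc] [d hd]; exists (code_subst d c) => n; apply: eval_subst (hc n).
Qed.

(** * Total recursive functions of fixed arity *)

Definition rec (Y : set nat) (k : nat) (f : seq nat -> nat) : Prop :=
  exists c, forall v, size v = k -> eval Y c v (f v).

Lemma rec_le X Y k f : turing_le X Y -> rec X k f -> rec Y k f.
Proof.
by move=> [d hd] [c hc]; exists (code_subst d c) => v /hc; apply: eval_subst.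
Qed.

Lemma rec_ext Y k f g : (forall v, size v = k -> f v = g v) ->
  rec Y k f -> rec Y k g.
Proof. by move=> h [c hc]; exists c => v sv; rewrite -h //; apply: hc. Qed.

Lemma rec_comp Y k (gs : seq (seq nat -> nat)) f :
  (forall i, i < size gs -> rec Y k (nth (fun=> 0) gs i)) ->
  rec Y (size gs) f ->
  rec Y k (fun v => f [seq g v | g <- gs]).
Proof.
move=> hgs [c hc].
have [cs hcs] : exists cs, forall v, size v = k -> evals Y cs v [seq g v | g <- gs].
  elim: gs {hc} hgs => [|g gs IH] h; first by exists [::] => v _; constructor.
  have [cs hcs] := IH (fun i => h i.+1).
  have [d hd] := h 0 isT.
  by exists (d :: cs) => v sv; constructor; [apply: hd|apply: hcs].
by exists (CComp c cs) => v sv; apply: eval_comp (hcs v sv) _; apply: hc; rewrite size_map.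
Qed.

Lemma rec_proj Y k i : i < k -> rec Y k (fun v => nth 0 v i).
Proof. by move=> ik; exists (CProj i) => v sv; constructor; rewrite sv. Qed.

Lemma rec_succ Y : rec Y 1 (fun v => (nth 0 v 0).+1).
Proof. by exists CSucc => -[|x [|]] //= _; constructor. Qed.

Lemma rec_oracle Y : rec Y 1 (fun v => chi Y (nth 0 v 0)).
Proof. by exists COracle => -[|x [|]] //= _; constructor. Qed.

Lemma rec_comp1 Y k f g : rec Y 1 f -> rec Y k g -> rec Y k (fun v => f [:: g v]).
Proof. by move=> hf hg; apply: (@rec_comp Y k [:: g]) => // -[]. Qed.

Lemma rec_comp2 Y k f g h : rec Y 2 f -> rec Y k g -> rec Y k h ->
  rec Y k (fun v => f [:: g v; h v]).
Proof. by move=> hf hg hh; apply: (@rec_comp Y k [:: g; h]) => // -[|[|]]. Qed.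

Lemma rec_const Y k n : rec Y k (fun=> n).
Proof.
elim: n => [|n IH]; first by exists CZero => v _; constructor.
exact: rec_comp1 (rec_succ Y) IH.
Qed.

Definition prec (f g : seq nat -> nat) (v : seq nat) : nat :=
  nat_rect (fun=> nat) (f (behead v)) (fun k z => g [:: k, z & behead v]) (head 0 v).

Lemma rec_prec Y k f g : rec Y k f -> rec Y k.+2 g -> rec Y k.+1 (prec f g).
Proof.
move=> [c hc] [d hd]; exists (CPrec c d) => -[//|n v] /= [sv].
rewrite /prec /=; elim: n => [|n IH] /=; first by constructor; exact: hc.
by apply: eval_precS IH _; apply: hd; rewrite /= sv.
Qed.

Definition app2 (f : nat -> nat -> nat) (v : seq nat) := f (nth 0 v 0) (nth 0 v 1).

Lemma seq2 (v : seq nat) : size v = 2 -> v = [:: nth 0 v 0; nth 0 v 1].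
Proof. by case: v => [|a [|b [|]]]. Qed.
Lemma seq1 (v : seq nat) : size v = 1 -> v = [:: nth 0 v 0].
Proof. by case: v => [|a [|]]. Qed.

Lemma rec_add Y : rec Y 2 (app2 addn).
Proof.
apply: (@rec_ext _ _ (prec (fun v => nth 0 v 0) (fun v => (nth 0 v 1).+1))).
  move=> v /seq2 ->; rewrite /prec /app2 /=.
  by elim: (nth 0 v 0) => //= n ->.
apply: rec_prec; first exact: rec_proj.
by apply: (rec_comp1 (rec_succ Y)); apply: rec_proj.
Qed.

Lemma rec_mul Y : rec Y 2 (app2 muln).
Proof.
apply: (@rec_ext _ _ (prec (fun=> 0) (fun v => app2 addn [:: nth 0 v 1; nth 0 v 2]))).
  move=> v /seq2 ->; rewrite /prec /app2 /=.
  by elim: (nth 0 v 0) => //= n ->; rewrite mulSn addnC.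
apply: rec_prec; first exact: rec_const.
by apply: rec_comp2; [exact: rec_add|apply: rec_proj|apply: rec_proj].
Qed.

Lemma rec_pred Y : rec Y 1 (fun v => (nth 0 v 0).-1).
Proof.
apply: (@rec_ext _ _ (prec (fun=> 0) (fun v => nth 0 v 0))).
  by move=> v /seq1 ->; rewrite /prec /=; case: (nth 0 v 0).
by apply: rec_prec; [exact: rec_const|apply: rec_proj].
Qed.

Lemma rec_sub Y : rec Y 2 (app2 subn).
Proof.
(* [CPrec] recurses on its first argument, so subtraction is built with the subtrahend first and
   swapped afterwards. *)
have h : rec Y 2 (app2 (fun a b => b - a)).
  apply: (@rec_ext _ _ (prec (fun v => nth 0 v 0) (fun v => (nth 0 v 1).-1))).
    move=> v /seq2 ->; rewrite /prec /app2 /=.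
    by elim: (nth 0 v 0) => //= [|n ->]; rewrite ?subn0 // subnS.
  apply: rec_prec; first exact: rec_proj.
  by apply: (rec_comp1 (rec_pred Y)); apply: rec_proj.
apply: (@rec_ext _ _ (fun v => app2 (fun a b => b - a) [:: nth 0 v 1; nth 0 v 0])) => //.
by apply: rec_comp2; [|apply: rec_proj|apply: rec_proj].
Qed.

Lemma rec_isz Y : rec Y 1 (fun v => nth 0 v 0 == 0 : nat).
Proof.
apply: (@rec_ext _ _ (fun v => app2 subn [:: 1; nth 0 v 0])).
  by move=> v _; rewrite /app2 /=; case: (nth 0 v 0).
by apply: rec_comp2; [exact: rec_sub|exact: rec_const|apply: rec_proj].
Qed.

Section Arith.
Variables (Y : set nat) (k : nat).
Implicit Types f g h : seq nat -> nat.

Lemma recD f g : rec Y k f -> rec Y k g -> rec Y k (fun v => f v + g v).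
Proof. exact: (rec_comp2 (rec_add Y)). Qed.
Lemma recM f g : rec Y k f -> rec Y k g -> rec Y k (fun v => f v * g v).
Proof. exact: (rec_comp2 (rec_mul Y)). Qed.
Lemma recB f g : rec Y k f -> rec Y k g -> rec Y k (fun v => f v - g v).
Proof. exact: (rec_comp2 (rec_sub Y)). Qed.
Lemma recZ f : rec Y k f -> rec Y k (fun v => f v == 0 : nat).
Proof. exact: (rec_comp1 (rec_isz Y)). Qed.

End Arith.

Definition decides (Y : set nat) (k : nat) (P : seq nat -> Prop) : Prop :=
  rec Y k (fun v => `[< P v >] : nat).

Section Decide.
Variables (Y : set nat) (k : nat).
Implicit Types P Q : seq nat -> Prop.

Lemma decides_ext P Q : (forall v, size v = k -> P v <-> Q v) ->
  decides Y k P -> decides Y k Q.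
Proof.
by move=> h; apply: rec_ext => v sv; congr nat_of_bool; apply: asbool_equiv_eq; exact: h.
Qed.

Lemma decides_eq0 f : rec Y k f -> decides Y k (fun v => f v = 0).
Proof.
by move=> /recZ; apply: rec_ext => v _; congr nat_of_bool; apply/eqP/asboolP.
Qed.

Lemma decides_not P : decides Y k P -> decides Y k (fun v => ~ P v).
Proof.
move=> /recZ; apply: rec_ext => v _; rewrite asbool_neg.
by case: `[< _ >].
Qed.

Lemma decides_and P Q : decides Y k P -> decides Y k Q ->
  decides Y k (fun v => P v /\ Q v).
Proof.
move=> hP hQ; apply: rec_ext (recM hP hQ) => v _; rewrite asbool_and.
by rewrite mulnb.
Qed.

Lemma decides_or P Q : decides Y k P -> decides Y k Q ->
  decides Y k (fun v => P v \/ Q v).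
Proof.
move=> hP hQ; apply: decides_ext (decides_not (decides_and (decides_not hP) (decides_not hQ))).
by move=> v _; rewrite -not_orE; split=> [/contrapT|h]; last apply.
Qed.

Lemma decides_imp P Q : decides Y k P -> decides Y k Q ->
  decides Y k (fun v => P v -> Q v).
Proof.
move=> hP hQ; apply: decides_ext (decides_or (decides_not hP) hQ) => v _.
by rewrite implyE.
Qed.

Lemma decides_lt f g : rec Y k f -> rec Y k g -> decides Y k (fun v => f v < g v).
Proof.
move=> hf hg; have hsf := recD (rec_const Y k 1) hf.
by apply: decides_ext (decides_eq0 (recB hsf hg)) => v _; lia.
Qed.

Lemma decides_eq f g : rec Y k f -> rec Y k g -> decides Y k (fun v => f v = g v).
Proof.
move=> hf hg.
apply: decides_ext (decides_and (decides_not (decides_lt hf hg)) (decides_not (decides_lt hg hf))).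
by move=> v _; lia.
Qed.

End Decide.

Lemma rec_mu Y k (P : seq nat -> Prop) : decides Y k.+1 P ->
  (forall v, size v = k -> exists n, P (n :: v)) ->
  exists2 f, rec Y k f & forall v, size v = k -> P (f v :: v).
Proof.
move=> hP ex.
(* [CMu] searches for the value 0, hence the negation. *)
have [c hc] := decides_not hP.
have /choice[f hf] : forall v, exists y, size v = k -> `[< P (y :: v) >] /\
    forall z, z < y -> ~ P (z :: v).
  move=> v.
  have [sv|/eqP sv] := eqVneq (size v) k; last by exists 0.
  have ex' : exists n, `[< P (n :: v) >] by have [n /asboolP] := ex v sv; exists n.
  case: (ex_minnP ex') => m hm mn; exists m => _; split => // z zm /asboolP /mn.
  by rewrite leqNgt zm.
exists f; last by move=> v /hf [/asboolP].
exists (CMu c) => v sv; have [h1 h2] := hf v sv.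
apply: (eval_mu (w := fun=> 0)).
  move=> z /h2 /asboolP; have := hc (z :: v); rewrite /= sv => /(_ erefl).
  by case: `[< _ >].
have := hc (f v :: v); rewrite /= sv => /(_ erefl).
by rewrite asbool_neg h1.
Qed.

Lemma rec_cons Y k f g : rec Y k.+1 f -> rec Y k g ->
  rec Y k (fun v => f (g v :: v)).
Proof.
move=> hf hg.
pose gs := g :: [seq (fun v => nth 0 v i) | i <- iota 0 k].
have sg : size gs = k.+1 by rewrite /= size_map size_iota.
have h : rec Y k (fun v => f [seq h v | h <- gs]).
  apply: rec_comp; last by rewrite sg.
  move=> [//|i]; rewrite sg ltnS /= => ik.
  rewrite (nth_map 0) ?size_iota // nth_iota //; exact: rec_proj.
apply: rec_ext h => v sv; rewrite /= -map_comp; congr (f (_ :: _)).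
by rewrite -[RHS](mkseq_nth 0) sv.
Qed.

Lemma decides_all Y k (P : seq nat -> Prop) f : decides Y k.+1 P -> rec Y k f ->
  decides Y k (fun v => forall n, n < f v -> P (n :: v)).
Proof.
move=> hP hf.
(* [gs] rearranges the arguments of the recursion step, dropping the accumulated value in position
   1. *)
pose gs := (fun v => nth 0 v 0) :: [seq (fun v => nth 0 v i.+2) | i <- iota 0 k].
have sg : size gs = k.+1 by rewrite /= size_map size_iota.
have hP' : decides Y k.+2 (fun v => P [seq h v | h <- gs]).
  apply: (@rec_comp Y k.+2 gs (fun v => `[< P v >] : nat)); last by rewrite sg.
  move=> [|i]; rewrite sg; first by move=> _; apply: rec_proj.
  rewrite ltnS /= => ik.
  rewrite (nth_map 0) ?size_iota // nth_iota //; exact: rec_proj.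
have hQ : rec Y k.+1 (prec (fun=> 1) (fun v => nth 0 v 1 * `[< P [seq h v | h <- gs] >])).
  apply: rec_prec; first exact: rec_const.
  by apply: recM => //; apply: rec_proj.
apply: rec_ext (rec_cons hQ hf) => v sv.
rewrite /prec /=; elim: (f v) => [|n IH] /=; first by rewrite asboolT.
rewrite IH mulnb -map_comp.
have -> : [seq ((fun f0 => f0 [:: n, (nat_rect (fun=> nat) 1
   (fun k0 z => z * `[< P [seq h [:: k0, z & v] | h <- gs] >]) n) & v]) \o
    (fun i (v0 : seq nat) => nth 0 v0 i.+2)) i | i <- iota 0 k] = v.
  by rewrite -[RHS](mkseq_nth 0) sv.
congr nat_of_bool; rewrite -asbool_and; apply: asbool_equiv_eq; split.
  by case=> h1 h2 i; rewrite ltnS leq_eqVlt => /orP[/eqP ->//|/h1].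
by move=> h; split; [move=> i ni; apply: h; apply: ltnW|apply: h].
Qed.

(** * Joins *)

Lemma chi_decides (X Y : set nat) : turing_le X Y -> decides Y 1 (fun v => X (nth 0 v 0)).
Proof.
move=> XY; apply: rec_ext (rec_le XY (rec_oracle X)) => v _.
by congr nat_of_bool; apply/idP/asboolP => [/set_mem|/mem_set].
Qed.

Lemma turing_le_decides (X Y : set nat) : decides Y 1 (fun v => X (nth 0 v 0)) -> turing_le X Y.
Proof.
move=> [c hc]; exists c => n; have := hc [:: n] erefl.
suff -> : `[< X (nth 0 [:: n] 0) >] = (n \in X) by [].
by apply/asboolP/idP => [/mem_set|/set_mem].
Qed.

Lemma joinE (X Y : set nat) n : turing_join X Y n <-> (if odd n then Y n./2 else X n./2).
Proof.
rewrite /turing_join; split.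
  by case=> -[m hm <-]; rewrite /= ?odd_double ?doubleK //= uphalf_double.
have := odd_double_half n; case: (odd n) => e h; [right|left]; exists n./2 => //.
Qed.

Lemma join_even X Y n : turing_join X Y n.*2 <-> X n.
Proof. by rewrite joinE odd_double doubleK. Qed.

Lemma join_odd X Y n : turing_join X Y n.*2.+1 <-> Y n.
Proof. by rewrite joinE /= odd_double /= uphalf_double. Qed.

Lemma rec_double Y k f : rec Y k f -> rec Y k (fun v => (f v).*2).
Proof. by move=> h; apply: rec_ext (recD h h) => v _; rewrite addnn. Qed.

Lemma rec_half Y k f : rec Y k f -> rec Y k (fun v => (f v)./2).
Proof.
suff h : rec Y 1 (fun v => (nth 0 v 0)./2) by exact: (rec_comp1 h).
(* Half of [n] is found by searching for the [m] with [2m <= n < 2m + 2]. *)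
have dP : decides Y 2 (fun v => nth 0 v 1 < (nth 0 v 0).+1.*2).
  apply: decides_lt; first exact: rec_proj.
  by apply: rec_double; apply: (rec_comp1 (rec_succ Y)); apply: rec_proj.
have dQ : decides Y 2 (fun v => (nth 0 v 0).*2 < (nth 0 v 1).+1).
  apply: decides_lt; first by apply: rec_double; apply: rec_proj.
  by apply: (rec_comp1 (rec_succ Y)); apply: rec_proj.
have [v _|f' hf' hP] := rec_mu (decides_and dP dQ).
  by exists (nth 0 v 0)./2; rewrite /=; lia.
by apply: rec_ext hf' => v /hP /=; lia.
Qed.

Lemma decides_odd Y k f : rec Y k f -> decides Y k (fun v => odd (f v)).
Proof.
move=> h; apply: decides_ext (decides_not (decides_eq (rec_double (rec_half h)) h)).
by move=> v _; rewrite -[in X in _ <> X](odd_double_half (f v)); case: odd; lia.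
Qed.

Lemma turing_join_l X Y : turing_le X (turing_join X Y).
Proof.
apply: turing_le_decides.
have h : decides (turing_join X Y) 1
    (fun v => turing_join X Y (nth 0 [:: (nth 0 v 0).*2] 0)).
  apply: (rec_comp1 (chi_decides (turing_le_refl _))).
  by apply: rec_double; apply: rec_proj.
by apply: decides_ext h => v _; exact: join_even.
Qed.

Lemma turing_join_r X Y : turing_le Y (turing_join X Y).
Proof.
apply: turing_le_decides.
have h : decides (turing_join X Y) 1
    (fun v => turing_join X Y (nth 0 [:: (nth 0 v 0).*2.+1] 0)).
  apply: (rec_comp1 (chi_decides (turing_le_refl _))).
  by apply: (rec_comp1 (rec_succ _)); apply: rec_double; apply: rec_proj.
by apply: decides_ext h => v _; exact: join_odd.
Qed.

Lemma turing_join_le X Y Z :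
  turing_le X Z -> turing_le Y Z -> turing_le (turing_join X Y) Z.
Proof.
move=> hX hY; apply: turing_le_decides.
have hh := rec_half (rec_proj Z (ltn0Sn 0)).
have dX : decides Z 1 (fun v => X (nth 0 [:: (nth 0 v 0)./2] 0)).
  exact: (rec_comp1 (chi_decides hX)).
have dY : decides Z 1 (fun v => Y (nth 0 [:: (nth 0 v 0)./2] 0)).
  exact: (rec_comp1 (chi_decides hY)).
have dO := decides_odd (rec_proj Z (ltn0Sn 0)).
apply: decides_ext (decides_or (decides_and dO dY) (decides_and (decides_not dO) dX)).
move=> v _; rewrite joinE /=; case: odd; split.
- by case=> -[].
- by left.
- by case=> -[].
- by right.
Qed.

(** * Operators *)

Definition oper := set nat -> seq nat -> seq nat -> Prop.

Definition open (F : oper) : Prop :=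
  forall X U V, F X U V -> local (fun Y => F Y U V) X.

Definition monotone (F : oper) : Prop :=
  forall X U V U' V', {subset U <= U'} -> {subset V <= V'} ->
    F X U V -> F X U' V'.

Definition above (x : nat) (U : seq nat) : Prop := forall z, z \in U -> x < z.

Definition essential (P : seq nat -> seq nat -> Prop) : Prop :=
  forall x, exists2 U, above x U &
    forall y, exists2 V, above y V & P U V.

Definition hits (A B : set nat) (P : seq nat -> seq nat -> Prop) : Prop :=
  exists U V, [/\ forall x, x \in U -> A x, forall x, x \in V -> B x & P U V].

Definition graph (f : nat -> nat) : set nat := fun p => exists n, p = pairc n (f n).

Definition fgraph (s : seq nat) : set nat :=
  fun p => exists2 n, n < size s & p = pairc n (nth 0 s n).

Lemma agree_join u X X' Y Y' : agree u X X' -> agree u Y Y' ->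
  agree u (turing_join X Y) (turing_join X' Y').
Proof.
move=> hX hY n nu; rewrite !joinE.
have lt : n./2 < u by lia.
by case: odd; [apply: hY|apply: hX].
Qed.

Lemma agree_graph u f s : s = mkseq f (size s) -> u <= size s ->
  agree u (fgraph s) (graph f).
Proof.
move=> e us p pu.
have nthE n : n < size s -> nth 0 s n = f n by move=> h; rewrite e nth_mkseq.
split=> [[n ns ->]|[n pE]]; first by exists n; rewrite nthE.
have ns : n < size s by have := pairc_gel n (f n); lia.
by exists n; rewrite ?nthE.
Qed.

(** By [pairc_gel], the graphs of all functions extending [s] agree with
    [fgraph s] below [size s]. *)
Definition forced (F : oper) (X : set nat) (s U V : seq nat) : Prop :=
  exists2 u, u <= size s &
    forall Z, agree u (turing_join X (fgraph s)) Z -> F Z U V.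

Lemma forced_graph F X s U V f : s = mkseq f (size s) ->
  forced F X s U V -> F (turing_join X (graph f)) U V.
Proof.
move=> e [u us h]; apply: h; apply: agree_join => //.
exact: agree_graph.
Qed.

Lemma graph_forced F X U V f : open F -> F (turing_join X (graph f)) U V ->
  exists u, forall l, u <= l -> forced F X (mkseq f l) U V.
Proof.
move=> oF /oF[u h]; exists u => l ul; exists u; first by rewrite size_mkseq.
move=> Z hZ; apply: h; apply: agree_trans hZ; apply: agree_join => //.
by apply: agree_sym; apply: agree_graph; rewrite size_mkseq.
Qed.

Lemma forced_mono F X s U V U' V' : monotone F ->
  {subset U <= U'} -> {subset V <= V'} -> forced F X s U V -> forced F X s U' V'.
Proof. by move=> mF hU hV [u us h]; exists u => // Z /h; apply: mF. Qed.

Lemma forced_local F X s U V : forced F X s U V -> local (fun Y => forced F Y s U V) X.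
Proof.
move=> [u us h]; exists u => Y XY; exists u => // Z hZ; apply: h.
by apply: agree_trans hZ; apply: agree_join.
Qed.

Definition splits (r : rel nat) (s t : seq nat) : bool :=
  [&& pairwise r s, pairwise (fun x y => r y x) t & allrel r s t].

(** This turns a requirement on each of the two sequences into a single relation over [X]. It
    inherits monotonicity and openness, so the invariant for [X] can be applied to it. *)
Definition ext (R : set nat -> rel nat) (F G : oper) (s t : seq nat) : oper :=
  fun X U V => exists s' t', [/\ prefix s s', prefix t t', splits (R X) s' t',
    forced F X s' U V & forced G X t' U V].

Lemma ext_mono R F G s t : monotone F -> monotone G -> monotone (ext R F G s t).
Proof.
move=> mF mG X U V U' V' hU hV [s' [t' [h1 h2 h3 h4 h5]]].
by exists s', t'; split => //; [apply: forced_mono h4|apply: forced_mono h5].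
Qed.

(** Only positive instances have to persist: a divergent computation also makes [query] false, and
    no finite part of the oracle need reveal that. *)
Definition open_rel (R : set nat -> rel nat) : Prop :=
  forall x y X, R X x y -> local (fun Y => R Y x y) X.

Lemma local_pairwise (R : set nat -> rel nat) s X : open_rel R ->
  pairwise (R X) s -> local (fun Y => pairwise (R Y) s) X.
Proof.
move=> oR; elim: s => [|a s IH] /=; first by exists 0.
move=> /andP[/allP h1 /IH h2].
have h3 : local (fun Y => forall x, x \in s -> R Y a x) X.
  by apply: local_all => x /h1 /oR.
by apply: local_imp (local_and h2 h3) => Y [-> /allP ->].
Qed.

Lemma local_splits R s t X : open_rel R -> splits (R X) s t ->
  local (fun Y => splits (R Y) s t) X.
Proof.
move=> oR /and3P[h1 h2 /allrelP h3].
have l1 := local_pairwise oR h1.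
have l2 : local (fun Y => pairwise (fun x y => R Y y x) t) X.
  by apply: (@local_pairwise (fun Y x y => R Y y x)) => // x y Z; apply: oR.
have l3 : local (fun Y => forall x, x \in s -> forall y, y \in t -> R Y x y) X.
  by apply: local_all => x xs; apply: local_all => y yt; apply: oR; apply: h3.
apply: local_imp (local_and l1 (local_and l2 l3)) => Y [k1 [k2 k3]].
by apply/and3P; split=> //; apply/allrelP => x y xs yt; apply: k3.
Qed.

Lemma ext_open R F G s t : open_rel R -> open (ext R F G s t).
Proof.
move=> oR X U V [s' [t' [h1 h2 h3 h4 h5]]].
apply: local_imp (local_and (local_splits oR h3)
  (local_and (forced_local h4) (forced_local h5))).
by move=> Y [k3 [k4 k5]]; exists s', t'.
Qed.

(** Monotonicity lets the witnesses for [F] and [G] be merged, and the choice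
    of [U] before [V] in [essential] is what makes the merged family
    essential. *)
Lemma essential_ext R F G s t X (S T : set (seq nat)) :
  monotone F -> monotone G ->
  (forall s' t', S s' -> T t' -> [/\ prefix s s', prefix t t' & splits (R X) s' t']) ->
  essential (fun U V => exists2 s', S s' & forced F X s' U V) ->
  essential (fun U V => exists2 t', T t' & forced G X t' U V) ->
  essential (ext R F G s t X).
Proof.
move=> mF mG hST eF eG x.
have [U hU eU] := eF x; have [U' hU' eU'] := eG x.
exists (U ++ U') => [z|y]; first by rewrite mem_cat => /orP[/hU|/hU'].
have [V hV [s' Ss fs]] := eU y; have [V' hV' [t' Tt ft]] := eU' y.
exists (V ++ V') => [z|]; first by rewrite mem_cat => /orP[/hV|/hV'].
have [h1 h2 h3] := hST _ _ Ss Tt; exists s', t'; split=> //.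
  by apply: forced_mono fs => // z zU; rewrite mem_cat zU.
by apply: forced_mono ft => // z zU; rewrite mem_cat zU orbT.
Qed.

(** Each instance uses a finite part of [graph f]. The lower bound [n] on the length lets the
    segment extend a prescribed one. *)
Lemma essential_graph F X f n : open F ->
  essential (F (turing_join X (graph f))) ->
  essential (fun U V => exists2 s, (exists2 l, n <= l & s = mkseq f l) & forced F X s U V).
Proof.
move=> oF e x; have [U hU eU] := e x; exists U => // y.
have [V hV FV] := eU y; exists V => //.
have [u hu] := graph_forced oF FV.
exists (mkseq f (maxn n u)); first by exists (maxn n u); rewrite ?leq_maxl.
by apply: hu; rewrite leq_maxr.
Qed.

(** * A countable family of operators *)

(** The embedding into generic trees makes codes countable, so that requirements mentioning them can
    be enumerated. *)
Fixpoint code_enc (c : code) : GenTree.tree nat :=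
  match c with
  | CZero => GenTree.Node 0 [::]
  | CSucc => GenTree.Node 1 [::]
  | CProj i => GenTree.Node 2 [:: GenTree.Leaf i]
  | COracle => GenTree.Node 3 [::]
  | CComp c cs => GenTree.Node 4 (code_enc c :: map code_enc cs)
  | CPrec c d => GenTree.Node 5 [:: code_enc c; code_enc d]
  | CMu c => GenTree.Node 6 [:: code_enc c]
  end.

Fixpoint code_dec (t : GenTree.tree nat) : code :=
  match t with
  | GenTree.Node 1 _ => CSucc
  | GenTree.Node 2 [:: GenTree.Leaf i] => CProj i
  | GenTree.Node 3 _ => COracle
  | GenTree.Node 4 (c :: cs) => CComp (code_dec c) (map code_dec cs)
  | GenTree.Node 5 [:: c; d] => CPrec (code_dec c) (code_dec d)
  | GenTree.Node 6 [:: c] => CMu (code_dec c)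
  | _ => CZero
  end.

Lemma code_encK : cancel code_enc code_dec.
Proof.
rewrite /cancel; fix IH 1; case=> //=.
- move=> c cs; rewrite IH; congr CComp.
  by elim: cs => //= d cs ->; rewrite IH.
- by move=> c d; rewrite !IH.
- by move=> c; rewrite IH.
Qed.

HB.instance Definition _ := Countable.copy code (can_type code_encK).

(** The flag [b] reverses the relation, which turns descending sequences into ascending ones. *)
Definition query (c : code) (b : bool) (X : set nat) : rel nat := fun x y =>
  `[< eval X c [:: if b then pairc x y else pairc y x] 1 >].

Lemma query_open c b : open_rel (query c b).
Proof.
move=> x y X /asboolP /eval_use; apply: local_imp => Y h; exact/asboolP.
Qed.

(** [OnU] excludes infinite [X]-computable subsets of [B], and [OnV] those of [A]. [Ext] is the
    closure needed for ADS, and [Triv] fills its second slot when only one sequence is built. *)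
Inductive name : Type :=
| Triv
| OnU of code
| OnV of code
| Ext of code & bool & name & name & seq nat & seq nat.

Fixpoint sem (a : name) : oper :=
  match a with
  | Triv => fun _ _ _ => True
  | OnU c => fun X U _ => exists2 z, z \in U & eval X c [:: z] 1
  | OnV c => fun X _ V => exists2 z, z \in V & eval X c [:: z] 1
  | Ext c b a1 a2 s t => ext (query c b) (sem a1) (sem a2) s t
  end.

Lemma sem_mono a : monotone (sem a).
Proof.
elim: a => [|c|c|c b a1 IH1 a2 IH2 s t] //=; last exact: ext_mono.
  by move=> X U V U' V' hU hV [z /hU zU h]; exists z.
by move=> X U V U' V' hU hV [z /hV zU h]; exists z.
Qed.

Lemma sem_open a : open (sem a).
Proof.
case: a => [|c|c|c b a1 a2 s t] /=.
- by move=> X U V _; exists 0.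
- by move=> X U V [z zU /eval_use]; apply: local_imp => Y h; exists z.
- by move=> X U V [z zU /eval_use]; apply: local_imp => Y h; exists z.
- by apply: ext_open; exact: query_open.
Qed.

Fixpoint name_enc (a : name) : GenTree.tree (code * bool * seq nat * seq nat) :=
  match a with
  | Triv => GenTree.Node 0 [::]
  | OnU c => GenTree.Node 1 [:: GenTree.Leaf (c, true, [::], [::])]
  | OnV c => GenTree.Node 2 [:: GenTree.Leaf (c, true, [::], [::])]
  | Ext c b a1 a2 s t =>
      GenTree.Node 3 [:: GenTree.Leaf (c, b, s, t); name_enc a1; name_enc a2]
  end.

Fixpoint name_dec (t : GenTree.tree (code * bool * seq nat * seq nat)) : name :=
  match t with
  | GenTree.Node 1 [:: GenTree.Leaf (c, _, _, _)] => OnU c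
  | GenTree.Node 2 [:: GenTree.Leaf (c, _, _, _)] => OnV c
  | GenTree.Node 3 [:: GenTree.Leaf (c, b, s, t); a1; a2] =>
      Ext c b (name_dec a1) (name_dec a2) s t
  | _ => Triv
  end.

Lemma name_encK : cancel name_enc name_dec.
Proof. by elim=> //= c b a1 -> a2 -> s t. Qed.

HB.instance Definition _ := Countable.copy name (can_type name_encK).

Definition dep_hyperimmune (A B X : set nat) : Prop :=
  forall a, essential (sem a X) -> hits A B (sem a X).

(** * Generic sequences *)

(** The Rasiowa-Sikorski construction: step [n] enters the [n]-th dense set, and dependent choice is
    made by a choice function. *)
Lemma generic_sequence (P : Type) (le : P -> P -> Prop) (K : P -> Prop)
    (D : nat -> P -> Prop) (p0 : P) :
  K p0 ->
  (forall n p, K p -> exists2 q, K q & le q p /\ D n q) ->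
  exists g : nat -> P, [/\ g 0 = p0, forall n, K (g n),
    forall n, le (g n.+1) (g n) & forall n, D n (g n.+1)].
Proof.
move=> K0 dense.
have /choice[h hh] : forall np : nat * P, exists q,
    K np.2 -> [/\ K q, le q np.2 & D np.1 q].
  move=> [n p] /=; have [Kp|nK] := pselect (K p); last by exists p.
  by have [q Kq [qp Dq]] := dense n p Kp; exists q.
pose g := fix g n := if n is m.+1 then h (m, g m) else p0.
have Kg n : K (g n) by elim: n => //= n /(hh (n, _)) [].
by exists g; split=> // n; have [] := hh (n, g n) (Kg n).
Qed.

Lemma prefix_chain (g : nat -> seq nat) : (forall n, prefix (g n) (g n.+1)) ->
  forall m n, m <= n -> prefix (g m) (g n).
Proof.
move=> h m n /subnK <-; elim: (n - m) => [|k IH]; first exact: prefix_refl.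
exact: prefix_trans IH (h _).
Qed.

Lemma limit_sequence (g : nat -> seq nat) :
  (forall n, prefix (g n) (g n.+1)) -> (forall l, exists n, l <= size (g n)) ->
  exists f, (forall n, g n = mkseq f (size (g n))) /\
            (forall l n, l <= size (g n) -> mkseq f l = take l (g n)).
Proof.
move=> /prefix_chain ch ub.
have /choice[k hk] : forall l, exists n, l < size (g n) by move=> l; have := ub l.+1.
pose f l := nth 0 (g (k l)) l.
have fE n i : i < size (g n) -> f i = nth 0 (g n) i.
  move=> ilt; rewrite /f.
  have [/ch|/ltnW /ch] := leqP (k i) n; move=> /prefixP[r ->]; rewrite nth_cat ?hk //.
  by rewrite ilt.
have E l n : l <= size (g n) -> mkseq f l = take l (g n).
  move=> ln; apply: (@eq_from_nth _ 0); first by rewrite size_mkseq size_takel.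
  move=> i; rewrite size_mkseq => il; rewrite nth_mkseq // nth_take //.
  by apply: fE; apply: leq_trans ln.
by exists f; split=> // n; rewrite (E _ n) ?take_size.
Qed.

Lemma pairwise_mkseq (r : rel nat) f : (forall l, pairwise r (mkseq f l)) ->
  forall n m, n < m -> r (f n) (f m).
Proof.
move=> h n m nm; have /(pairwiseP 0)/(_ n m) := h m.+1.
rewrite !inE size_mkseq ltnS leqnn (ltnW nm) => /(_ isT isT nm).
by rewrite !nth_mkseq // ltnS ltnW.
Qed.

(** * Sequences in linear orders *)

Definition strict_linear (r : rel nat) : Prop :=
  [/\ irreflexive r, transitive r & forall x y, x <> y -> r x y \/ r y x].

Definition gap (r : rel nat) (s t : seq nat) (z : nat) : Prop :=
  (forall x, x \in s -> r x z) /\ (forall y, y \in t -> r z y).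

Definition unbounded (P : nat -> Prop) : Prop :=
  forall m, exists2 n, m <= n & P n.

Lemma not_unbounded P : ~ unbounded P -> exists m, forall n, m <= n -> ~ P n.
Proof.
by move=> h; apply: contrapT => h'; apply: h => m; apply: contrapT => h'';
  apply: h'; exists m => n mn Pn; apply: h''; exists n.
Qed.

Definition valid (r : rel nat) (s t : seq nat) : Prop :=
  splits r s t /\ unbounded (gap r s t).

Lemma mem_prefix (s s' : seq nat) : prefix s s' -> {subset s <= s'}.
Proof. by move=> /prefixP[w ->] z zs; rewrite mem_cat zs. Qed.

Lemma pairwise_prefix (r : rel nat) s s' : prefix s s' -> pairwise r s' -> pairwise r s.
Proof. by move=> /prefixP[w ->]; rewrite pairwise_cat => /and3P[]. Qed.

Lemma splits_prefix r s s' t t' : prefix s s' -> prefix t t' -> splits r s' t' -> splits r s t.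
Proof.
move=> hs ht /and3P[h1 h2 /allrelP h3]; apply/and3P; split.
- exact: pairwise_prefix h1.
- exact: pairwise_prefix h2.
- apply/allrelP => x y xs yt; apply: h3; [exact: mem_prefix xs|exact: mem_prefix yt].
Qed.

Lemma splits_rev r s t : splits r s t = splits (fun x y => r y x) t s.
Proof.
by rewrite /splits; apply/and3P/and3P => -[h1 h2 /allrelP h3]; split=> //;
  apply/allrelP => x y xs yt; apply: h3.
Qed.

Lemma valid_rev r s t : valid r s t <-> valid (fun x y => r y x) t s.
Proof.
rewrite /valid splits_rev.
by split=> -[-> h]; split=> // m; have [n mn [g1 g2]] := h m; exists n.
Qed.

Lemma splits_rcons r s t z : splits r s t -> gap r s t z -> splits r (rcons s z) t.
Proof.
move=> /and3P[h1 h2 /allrelP h3] [g1 g2]; apply/and3P; split=> //.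
  by rewrite pairwise_rcons h1 andbT; apply/allP.
apply/allrelP => x y; rewrite mem_rcons inE => /orP[/eqP ->|xs yt]; first exact: g2.
exact: h3.
Qed.

Lemma list_above (s : seq nat) : exists m, forall x, x \in s -> x < m.
Proof.
elim: s => [|a s [m h]]; first by exists 0.
exists (maxn a.+1 m) => x; rewrite inE => /orP[/eqP ->|/h]; lia.
Qed.

(** A late element of the old gap is either above all of [s'], hence in the gap of [(s', t)], or
    below some element of [s'], hence below all of [t']. One of the two cases occurs infinitely
    often. *)
Lemma valid_side r s s' t t' : strict_linear r -> valid r s t ->
  prefix s s' -> prefix t t' -> splits r s' t' -> valid r s' t \/ valid r s t'.
Proof.
move=> [_ tr tot] [_ gap_inf] hs ht sp; apply: contrapT => /not_orP[n1 n2].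
have sp1 : splits r s' t by apply: splits_prefix sp; rewrite ?prefix_refl.
have sp2 : splits r s t' by apply: splits_prefix sp; rewrite ?prefix_refl.
have [m1 hm1] : exists m, forall n, m <= n -> ~ gap r s' t n.
  by apply: not_unbounded => h; apply: n1.
have [m2 hm2] : exists m, forall n, m <= n -> ~ gap r s t' n.
  by apply: not_unbounded => h; apply: n2.
(* Beyond [m3] the number [n] is not in [s'], so totality compares it with each element of [s']. *)
have [m3 hm3] := list_above s'.
have [n nm [g1 g2]] := gap_inf (m1 + m2 + m3).
have [h|/existsNP[x /not_implyP[xs nr]]] := pselect (forall x, x \in s' -> r x n).
  by apply: (hm1 n) => //; lia.
apply: (hm2 n); first lia.
have [||rnx] := tot x n; [|by []|].
  by have := hm3 x xs; lia.
split=> // y yt; apply: tr rnx _.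
by have /and3P[_ _ /allrelP] := sp; apply.
Qed.

Lemma prefix_mkseq (f : nat -> nat) k l : k <= l -> prefix (mkseq f k) (mkseq f l).
Proof.
by move=> /subnKC <-; rewrite /mkseq iotaD map_cat prefix_prefix.
Qed.

(** * Ascending sequences inside a gap of order type omega *)

Section OneSided.
Variables (A B X : set nat) (c : code) (b : bool) (s0 t0 : seq nat).
Let r := query c b X.
(** By [stuck] each element of the infinite gap has only finitely many gap elements below it. *)
Hypotheses (lin : strict_linear r) (val0 : valid r s0 t0)
  (stuck : forall z, gap r s0 t0 z ->
     exists m, forall n, m <= n -> gap r s0 t0 n -> ~ r n z)
  (DH : dep_hyperimmune A B X).

Let K (s : seq nat) : Prop := prefix s0 s /\ splits r s t0.
(** A decoded requirement asks for a length or treats a name [a]. In the second case [s] either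
    forces [a] inside [A] and [B], or has a prefix at which the extension relation fails to be
    essential. *)
Let D (n : nat) (s : seq nat) : Prop := match @unpickle (nat + name)%type n with
  | Some (inl l) => is_true (l <= size s)
  | Some (inr a) =>
      (exists U V, [/\ forall x, x \in U -> A x, forall x, x \in V -> B x &
         forced (sem a) X s U V]) \/
      (exists2 s1, prefix s1 s & ~ essential (sem (Ext c b a Triv s1 t0) X))
  | None => True
  end.

(** What was added to [s0] lies in the gap, so almost every gap element is above all of [s] and may
    be appended. *)
Lemma stuck_extend s : K s -> exists z, K (rcons s z).
Proof.
move=> [ps sp]; have [_ tr tot] := lin.
suff [m hm] : exists m, forall n, m <= n -> gap r s0 t0 n -> forall x, x \in s -> r x n.
  have [n mn gn] := val0.2 m; exists n; split.
    exact: prefix_trans ps (prefix_rcons _ _).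
  by apply: splits_rcons => //; split; [apply: hm|exact: gn.2].
have memT x : x \in s -> x \in s0 \/ gap r s0 t0 x.
  move/prefixP: ps sp => [w ->] /and3P[]; rewrite pairwise_cat.
  move=> /and3P[/allrelP h1 _ _] _ /allrelP h2.
  rewrite mem_cat => /orP[|xw]; first by left.
  right; split=> y yy; first exact: h1.
  by apply: h2; rewrite // mem_cat xw orbT.
move: {sp ps} memT; elim: s => [|a s IH] memT; first by exists 0.
have [m hm] := IH (fun x xs => memT x (mem_behead (s := a :: s) xs)).
have [as0|ga] := memT a (mem_head _ _).
  exists m => n mn gn x; rewrite inE => /orP[/eqP ->|]; last exact: hm.
  by apply: gn.1.
have [m' hm'] := stuck ga.
(* Past [m'] no gap element is below [a], and past [a] none equals it, so totality puts [n] above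
   [a]. *)
exists (m + m' + a.+1) => n mn gn x; rewrite inE => /orP[/eqP ->|xs].
  have [||] := tot a n => //; first by lia.
  by move/(hm' n); case=> //; lia.
by apply: hm => //; lia.
Qed.

Lemma stuck_dense n s : K s -> exists2 s', K s' & prefix s s' /\ D n s'.
Proof.
move=> Ks; rewrite /D; case: (unpickle n) => [[l|a]|].
- elim: l => [|l [s' Ks' [ps' ls']]]; first by exists s; rewrite ?prefix_refl.
  have [z Kz] := stuck_extend Ks'; exists (rcons s' z) => //; split.
    exact: prefix_trans ps' (prefix_rcons _ _).
  by rewrite size_rcons.
- have [ess|ness] := pselect (essential (sem (Ext c b a Triv s t0) X)).
    have [U [V [hU hV [s' [t' [ps pt sp fs _]]]]]] := DH ess.
    (* The extension [t'] is discarded: the upper sequence stays [t0]. *)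
    exists s'; first split.
    + exact: prefix_trans Ks.1 ps.
    + by apply: splits_prefix sp; rewrite ?prefix_refl.
    by split=> //; left; exists U, V.
  by exists s => //; split; [exact: prefix_refl|right; exists s; rewrite ?prefix_refl].
- by exists s; rewrite ?prefix_refl.
Qed.

(** If [a] is essential over the limit, the initial segments of [f] beyond [s1] make the extension
    relation at [s1] essential over [X]. This rules out the second way of treating [a], so [a] was
    forced. *)
Lemma one_sided : exists2 f : nat -> nat, (forall n m, n < m -> r (f n) (f m)) &
  dep_hyperimmune A B (turing_join X (graph f)).
Proof.
have K0 : K s0 by split; [exact: prefix_refl|exact: val0.1].
have [g [_ gK gle gD]] := generic_sequence K0 stuck_dense.
have [l|f [fE fT]] := limit_sequence gle.
  by have := gD (pickle (inl l : nat + name)); rewrite /D pickleK; eexists; eassumption.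
have big l : exists n, l <= size (g n).
  by have := gD (pickle (inl l : nat + name)); rewrite /D pickleK; eexists; eassumption.
have spl l : splits r (mkseq f l) t0.
  have [n ln] := big l; rewrite (fT _ n ln).
  by apply: splits_prefix (gK n).2; rewrite ?prefix_refl ?prefix_take.
exists f; first by apply: pairwise_mkseq => l; have /and3P[] := spl l.
move=> a ess; have := gD (pickle (inr a : nat + name)); rewrite /D pickleK.
set N := _.+1; case=> [[U [V [hU hV h]]]|[s1 ps1 []]].
  by exists U, V; split=> //; apply: forced_graph (fE N) h.
apply: (@essential_ext _ _ _ _ _ _ (fun s => exists2 l, size s1 <= l & s = mkseq f l)
   (fun t => t = t0)); [exact: sem_mono|by []| | |].
- move=> _ _ [l l1 ->] ->; split; [|exact: prefix_refl|exact: spl].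
  have ss1 := size_prefix ps1.
  have -> : s1 = mkseq f (size s1).
    by rewrite (fT _ N) //; move: ps1; rewrite prefixE => /eqP.
  exact: prefix_mkseq.
- exact: essential_graph (@sem_open a) ess.
(* [Triv] holds of empty lists and is forced by [t0] with use 0. *)
- move=> x; exists [::] => // y; exists [::] => //; exists t0 => //.
  by exists 0.
Qed.
End OneSided.

(** * Simultaneous ascending and descending sequences *)

Section TwoSided.
Variables (A B X : set nat) (c : code).
Let r := query c true X.
Hypotheses (lin : strict_linear r)
  (growl : forall s t, valid r s t -> exists z, valid r (rcons s z) t)
  (growr : forall s t, valid r s t -> exists z, valid r s (rcons t z))
  (DH : dep_hyperimmune A B X).

Let K (p : seq nat * seq nat) : Prop := valid r p.1 p.2.
Let le (q p : seq nat * seq nat) : Prop := prefix p.1 q.1 /\ prefix p.2 q.2.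
Let hit a s := exists U V,
  [/\ forall x, x \in U -> A x, forall x, x \in V -> B x & forced (sem a) X s U V].
(** Names are treated in pairs, one for each sequence, and meeting either half is enough. *)
Let D (n : nat) (p : seq nat * seq nat) : Prop :=
  match @unpickle (nat + name * name)%type n with
  | Some (inl l) => l <= size p.1 /\ l <= size p.2
  | Some (inr (a, a')) => [\/ hit a p.1, hit a' p.2 |
      exists s t, [/\ prefix s p.1, prefix t p.2 &
        ~ essential (sem (Ext c true a a' s t) X)]]
  | None => True
  end.

Let le_refl p : le p p. Proof. by split; exact: prefix_refl. Qed.

Lemma free_dense n p : K p -> exists2 q, K q & le q p /\ D n q.
Proof.
move=> Kp; rewrite /D; case: (unpickle n) => [[l|[a a']]|]; last by exists p.
- elim: l => [|l [[s t] Kst [[/= ps pt] [/= ls lt]]]]; first by exists p.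
  have [z Kz] := growl Kst; have [w Kw] := growr Kz.
  exists (rcons s z, rcons t w) => //=; rewrite !size_rcons; split=> //; split.
    exact: prefix_trans ps (prefix_rcons _ _).
  exact: prefix_trans pt (prefix_rcons _ _).
case: p Kp => [s t] Kst.
have [ess|ness] := pselect (essential (sem (Ext c true a a' s t) X)).
  have [U [V [hU hV [s' [t' [ps pt sp fs ft]]]]]] := DH ess.
  (* Both names are forced at the same [(U, V)], so whichever side is kept meets its half. *)
  case: (valid_side lin Kst ps pt sp) => Kq; [exists (s', t)|exists (s, t')] => //.
    split; first by split; rewrite ?prefix_refl.
    by apply: Or31; exists U, V.
  split; first by split; rewrite ?prefix_refl.
  by apply: Or32; exists U, V.
by exists (s, t) => //; split=> //; apply: Or33; exists s, t; rewrite !prefix_refl.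
Qed.

(** If the ascending limit fails at some [a], the pairs [(a, a')] show that the descending limit
    succeeds at every [a']: the first half was not met, and two essential names exclude the third
    alternative. *)
Lemma two_sided : unbounded (gap r [::] [::]) -> exists2 f : nat -> nat,
  (forall n m, n < m -> r (f n) (f m)) \/ (forall n m, n < m -> r (f m) (f n)) &
  dep_hyperimmune A B (turing_join X (graph f)).
Proof.
move=> g0; have K0 : K ([::], [::]) by [].
have [g [_ gK gle gD]] := generic_sequence K0 free_dense.
have big l : exists n, l <= size (g n).1 /\ l <= size (g n).2.
  by have := gD (pickle (inl l : nat + name * name)); rewrite /D pickleK; eexists; eassumption.
have [l|f0 [fE0 fT0]] := limit_sequence (fun n => (gle n).1).
  by have [n []] := big l; exists n.
have [l|f1 [fE1 fT1]] := limit_sequence (fun n => (gle n).2).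
  by have [n []] := big l; exists n.
have spl l l' : splits r (mkseq f0 l) (mkseq f1 l').
  have [n [ln ln']] := big (l + l').
  rewrite (fT0 _ n) ?(fT1 _ n); try lia.
  by apply: splits_prefix (gK n).1; rewrite ?prefix_take.
have [dh0|/existsNP[a /not_implyP[ess na]]] :=
  pselect (dep_hyperimmune A B (turing_join X (graph f0))).
  exists f0 => //; left.
  by apply: pairwise_mkseq => l; have /and3P[] := spl l 0.
exists f1.
  by right; apply: (@pairwise_mkseq (fun x y => r y x)) => l; have /and3P[] := spl 0 l.
move=> a' ess'.
have := gD (pickle (inr (a, a') : nat + name * name)); rewrite /D pickleK.
set N := _.+1; case=> [[U [V [hU hV h]]]|[U [V [hU hV h]]]|[s [t [ps pt []]]]].
- by case: na; exists U, V; split=> //; apply: forced_graph (fE0 N) h.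
- by exists U, V; split=> //; apply: forced_graph (fE1 N) h.
apply: (@essential_ext _ _ _ _ _ _ (fun s' => exists2 l, size s <= l & s' = mkseq f0 l)
   (fun t' => exists2 l, size t <= l & t' = mkseq f1 l)).
- exact: sem_mono.
- exact: sem_mono.
- move=> _ _ [l l1 ->] [l' l2 ->]; split; last exact: spl.
    have -> : s = mkseq f0 (size s).
      by rewrite (fT0 _ N) ?size_prefix //; move: ps; rewrite prefixE => /eqP.
    exact: prefix_mkseq.
  have -> : t = mkseq f1 (size t).
    by rewrite (fT1 _ N) ?size_prefix //; move: pt; rewrite prefixE => /eqP.
  exact: prefix_mkseq.
- exact: essential_graph (@sem_open a) ess.
- exact: essential_graph (@sem_open a') ess'.
Qed.
End TwoSided.

(** * Preservation of the invariant by ADS *)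

Lemma strict_linear_rev r : strict_linear r -> strict_linear (fun x y => r y x).
Proof.
move=> [h1 h2 h3]; split=> [x|y x z|x y]; first exact: h1.
  by move=> xy yz; apply: h2 yz xy.
by move=> /h3 [|]; [right|left].
Qed.

(** Appending [z] to [t] cuts the gap down to its elements below [z]. *)
Lemma valid_right r s t z : valid r s t -> gap r s t z ->
  unbounded (fun n => gap r s t n /\ r n z) -> valid r s (rcons t z).
Proof.
move=> [sp _] [g1 g2] h; split.
  by rewrite splits_rev; apply: splits_rcons => //; rewrite -splits_rev.
move=> m; have [n mn [[k1 k2] nz]] := h m; exists n => //; split=> // y.
by rewrite mem_rcons inE => /orP[/eqP ->|/k2].
Qed.

(** Either both ends of some gap can be approached forever, or some gap has
    order type [omega] or [omega*], where a one-sided sequence suffices. *)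
Lemma ads_preservation A B X c : strict_linear (query c true X) ->
  dep_hyperimmune A B X -> exists2 f : nat -> nat,
    (forall n m, n < m -> query c true X (f n) (f m)) \/
    (forall n m, n < m -> query c true X (f m) (f n)) &
    dep_hyperimmune A B (turing_join X (graph f)).
Proof.
set r := query c true X => lin DH.
have stuckP (q : rel nat) s t : valid q s t ->
    ~ (exists z, valid q s (rcons t z)) ->
    forall z, gap q s t z -> exists m, forall n, m <= n -> gap q s t n -> ~ q n z.
  move=> v nz z gz.
  have [|m hm] := @not_unbounded (fun n => gap q s t n /\ q n z).
    by move=> h; apply: nz; exists z; apply: valid_right.
  by exists m => n /hm h gn qn; apply: h.
(* If the upper sequence cannot be prolonged, the gap has type omega and an ascending sequence is
   built. *)
have [[s [t [v nz]]]|noB] := pselect (exists s t, valid r s t /\ ~ exists z, valid r s (rcons t z)).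
  have [f fasc fdh] := one_sided lin v (stuckP _ _ _ v nz) DH.
  by exists f => //; left.
have [[s [t [v nz]]]|noA] := pselect (exists s t, valid r s t /\ ~ exists z, valid r (rcons s z) t).
  (* The dual case, with a gap of type omega*, is the previous one for the reversed relation. *)
  have v' : valid (query c false X) t s by apply/valid_rev.
  have nz' : ~ exists z, valid (query c false X) t (rcons s z).
    by move=> [z /valid_rev vz]; apply: nz; exists z.
  have lin' : strict_linear (query c false X) := strict_linear_rev lin.
  have [f fasc fdh] := one_sided lin' v' (stuckP _ _ _ v' nz') DH.
  by exists f => //; right.
apply: two_sided => //.
- by move=> s t v; apply: contrapT => h; apply: noA; exists s, t.
- by move=> s t v; apply: contrapT => h; apply: noB; exists s, t.
- by move=> m; exists m.
Qed.

(** * The ground forcing *)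

Definition poset (F : nat -> nat -> Prop) : Prop :=
  [/\ forall x, F x x, forall x y, F x y -> F y x -> x = y &
      forall x y z, F x y -> F y z -> F x z].

(** A finite poset on [[0, len)], made into an order on [nat] by leaving the
    other numbers isolated, with labels: an element of [labA] lies below, and
    an element of [labB] is incomparable with, every number added later. *)
Record cond := Cond {
  len : nat;
  ord : nat -> nat -> Prop;
  labA : set nat;
  labB : set nat }.

(** The closure of the labels is dictated by transitivity: a number below an element of [labA] will
    also lie below all later numbers, and one above an element of [labB] can lie below none. *)
Record good (p : cond) : Prop := Good {
  good_poset : poset (ord p);
  good_le : forall x y, ord p x y -> x <> y -> x < y < len p;
  good_down : forall x y, ord p x y -> labA p y -> labA p x;
  good_up : forall x y, ord p x y -> labB p x -> labB p y;
  good_disj : forall x, labA p x -> ~ labB p x;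
  good_ltA : forall x, labA p x -> x < len p;
  good_ltB : forall x, labB p x -> x < len p }.

(** [ext_B] excludes one direction only; for good conditions the other is excluded by [good_le]. *)
Record extends (q p : cond) : Prop := Extends {
  ext_len : len p <= len q;
  ext_ord : forall x y, x < len p -> y < len p -> (ord q x y <-> ord p x y);
  ext_A : forall x y, labA p x -> len p <= y < len q -> ord q x y;
  ext_B : forall x y, labB p x -> len p <= y < len q -> ~ ord q x y;
  ext_labA : forall x, labA p x -> labA q x;
  ext_labB : forall x, labB p x -> labB q x }.

Lemma extends_refl p : extends p p.
Proof. by split=> // x y _; lia. Qed.

Lemma extends_trans q p o : good p -> extends q p -> extends o q -> extends o p.
Proof.
move=> gp h1 h2; have l1 := ext_len h1; have l2 := ext_len h2; split.
- exact: leq_trans l1 l2.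
- by move=> x y xp yp; rewrite (ext_ord h2) ?(ext_ord h1) //; lia.
- move=> x y Ax yo; have xp := good_ltA gp Ax.
  have [yq|yq] := ltnP y (len q).
    by rewrite (ext_ord h2) //; [apply: (ext_A h1) => //; lia|lia].
  by apply: (ext_A h2); [exact: ext_labA h1 _ Ax|lia].
- move=> x y Bx yo; have xp := good_ltB gp Bx.
  have [yq|yq] := ltnP y (len q).
    by rewrite (ext_ord h2) //; [apply: (ext_B h1) => //; lia|lia].
  by apply: (ext_B h2); [exact: ext_labB h1 _ Bx|lia].
- by move=> x /(ext_labA h1) /(ext_labA h2).
- by move=> x /(ext_labB h1) /(ext_labB h2).
Qed.

(** The new number [len p] is placed above exactly the elements of [labA]; their downward closure
    gives transitivity. *)
Lemma cond_grow p : good p -> exists2 q, good q & extends q p /\ len p < len q.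
Proof.
move=> gp; have [rf an tr] := good_poset gp.
have top z : ord p (len p) z -> z = len p.
  move=> h; apply: contrapT => ne; have := good_le gp h (fun e => ne (esym e)); lia.
have topr z : ord p z (len p) -> z = len p.
  move=> h; apply: contrapT => ne; have := good_le gp h ne; lia.
have nA : ~ labA p (len p) by move=> /(good_ltA gp); rewrite ltnn.
exists (Cond (len p).+1 (fun x y => ord p x y \/ labA p x /\ y = len p) (labA p) (labB p)).
  split=> /=.
  - split; first by left.
      move=> x y [xy|[Ax ey]] [yx|[Ay ex]].
      + exact: an.
      + by subst x; have e := top _ xy; subst y.
      + by subst y; have e := top _ yx; subst x.
      + by subst x.
    move=> x y z [xy|[Ax ey]] [yz|[Ay ez]].
    + by left; apply: tr xy yz.
    + by right; split=> //; apply: good_down xy Ay.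
    + by right; split=> //; apply: top; rewrite -ey.
    + by subst y.
  - move=> x y [/(good_le gp) h /h|[/(good_ltA gp)]]; lia.
  - move=> x y [|[//]]; exact: good_down.
  - move=> x y [|[Ax _ Bx]]; first exact: good_up.
    by case: (good_disj gp Ax Bx).
  - exact: good_disj.
  - by move=> x /(good_ltA gp) /ltnW.
  - by move=> x /(good_ltB gp) /ltnW.
split; last exact: ltnSn.
split=> //=.
- by move=> x y xp yp; split=> [[//|[_ ey]]|]; [lia|left].
- by move=> x y Ax yp; right; split=> //; lia.
- move=> x y Bx yp [xy|[Ax _]]; last by case: (good_disj gp Ax Bx).
  have ey : y = len p by lia.
  rewrite ey in xy; have ex := topr _ xy.
  by have := good_ltB gp Bx; rewrite ex ltnn.
Qed.

(** Unless [x] is in [labB], its whole down-closure can join [labA]: an element of [labB] below [x]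
    would put [x] into [labB]. *)
Lemma cond_label p x : good p -> x < len p ->
  exists2 q, good q & extends q p /\ (labA q x \/ labB q x).
Proof.
move=> gp xp; have [rf an tr] := good_poset gp.
have [Bx|nB] := pselect (labB p x).
  by exists p => //; split; [exact: extends_refl|right].
exists (Cond (len p) (ord p) (fun z => labA p z \/ ord p z x) (labB p)).
  split=> //=.
  - exact: good_le.
  - move=> z y zy [/(good_down gp zy)|yx]; first by left.
    by right; apply: tr zy yx.
  - exact: good_up.
  - move=> z [|zx Bz]; first exact: good_disj.
    by apply: nB; apply: good_up Bz.
  - move=> z [/(good_ltA gp)//|zx].
    by have [->//|/eqP ne] := eqVneq z x; have := good_le gp zx ne; lia.
  - exact: good_ltB.
split; last by left; right.
by split=> //= [z y _|z y _|z Az]; [lia|lia|left].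
Qed.

(** Orders of conditions refine the order of [nat], hence no element of [V]
    lies below an element of [U] and the two labels do not conflict. *)
Lemma cond_commit p r U V m : good p -> good r -> extends r p ->
  above (len p) U -> above (len p) V ->
  (forall u, u \in U -> u < m <= len r) -> (forall v, v \in V -> m <= v < len r) ->
  exists2 q, good q & [/\ extends q p, len q = len r, ord q = ord r,
    forall x, x \in U -> labA q x & forall x, x \in V -> labB q x].
Proof.
move=> gp gr rp aU aV hU hV; have [rf an tr] := good_poset gr.
have rle x y : ord r x y -> x <= y.
  by move=> xy; have [->//|/eqP ne] := eqVneq x y; have := good_le gr xy ne; lia.
have rlt x y : ord r x y -> x < len r -> y < len r.
  by move=> xy; have [->//|/eqP ne] := eqVneq x y; have := good_le gr xy ne; lia.
have lpr := ext_len rp.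
exists (Cond (len r) (ord r) (fun z => labA p z \/ exists2 u, u \in U & ord r z u)
  (fun z => labB p z \/ exists2 v, v \in V & ord r v z)); last first.
  split=> //=.
  - split=> //=.
    + exact: (ext_ord rp).
    + exact: (ext_A rp).
    + exact: (ext_B rp).
    + by left.
    + by left.
  - by move=> x xU; right; exists x.
  - by move=> x xV; right; exists x.
split=> //=.
- exact: good_le.
- move=> x y xy [Ay|[u uU yu]]; last by right; exists u => //; apply: tr xy yu.
  left; have yp := good_ltA gp Ay; have := rle _ _ xy => xley.
  by apply: (good_down gp) Ay; rewrite -(ext_ord rp) //; lia.
- move=> x y xy [Bx|[v vV vx]]; last by right; exists v => //; apply: tr vx xy.
  left; have xp := good_ltB gp Bx.
  have [yp|yp] := ltnP y (len p).
    by apply: (good_up gp) Bx; rewrite -(ext_ord rp).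
  have yr : y < len r by apply: rlt xy _; lia.
  by case: (ext_B rp Bx _ xy); lia.
(* An old [A] label is too small to lie above [V]; an old [B] label cannot lie below the newer [u];
   and [v <= z <= u] contradicts [u < m <= v]. *)
- move=> z [Az|[u uU zu]] [Bz|[v vV vz]].
  + exact: good_disj Bz.
  + by have := good_ltA gp Az; have := aV v vV; have := rle _ _ vz; lia.
  + by apply: (ext_B rp Bz _ zu); have := aU u uU; have := hU u uU; lia.
  + by have := rle _ _ (tr _ _ _ vz zu); have := hU u uU; have := hV v vV; lia.
- move=> z [/(good_ltA gp)|[u uU /rle]]; first lia.
  by have := hU u uU; lia.
- move=> z [/(good_ltB gp)|[v vV /rlt]]; first lia.
  by apply; have := hV v vV; lia.
Qed.

Definition oset (F : nat -> nat -> Prop) : set nat :=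
  fun n => exists x y, n = pairc x y /\ F x y.

Lemma osetE F x y : oset F (pairc x y) <-> F x y.
Proof.
by split=> [[x' [y' [/pairc_inj[-> ->]]]]//|h]; exists x, y.
Qed.

Lemma agree_oset u (F G : nat -> nat -> Prop) :
  (forall x y, x < u -> y < u -> (F x y <-> G x y)) -> agree u (oset F) (oset G).
Proof.
move=> h n nu; split=> -[x [y [e Fxy]]]; exists x, y; split=> //; apply/h => //;
  have := pairc_gel x y; have := pairc_ger x y; lia.
Qed.

Lemma ground_poset : exists (M : nat -> nat -> Prop) (A B : set nat),
  [/\ poset M, forall x, A x \/ B x, forall x, A x -> ~ B x,
      (forall x, A x -> exists m, forall y, m < y -> M x y) /\
      (forall x, B x -> exists m, forall y, m < y -> ~ M x y /\ ~ M y x) &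
      dep_hyperimmune A B (oset M)].
Proof.
pose met a q := exists U V, [/\ forall x, x \in U -> labA q x,
  forall x, x \in V -> labB q x & exists2 u, u <= len q &
    forall Z, agree u (oset (ord q)) Z -> sem a Z U V].
(* For a name, [q] either meets it or extends a condition none of whose extensions meets it. *)
pose D n q := match @unpickle (nat + name)%type n with
  | Some (inl l) => l < len q /\ (labA q l \/ labB q l)
  | Some (inr a) => met a q \/
      exists2 p, good p & extends q p /\ (forall r, good r -> extends r p -> ~ met a r)
  | None => True
  end.
pose p0 := Cond 0 (fun x y => x = y) set0 set0.
have good0 : good p0.
  split=> //=; try by [move=> x y -> | move=> x []].
  by split=> // x y z -> ->.
have dense n p : good p -> exists2 q, good q & extends q p /\ D n q.
  move=> gp; rewrite /D; case: (unpickle n) => [[l|a]|].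
  - have [q gq [qp lq]] : exists2 q, good q & extends q p /\ l < len q.
      elim: l => [|l [q gq [qp lq]]].
        by have [q gq [qp lq]] := cond_grow gp; exists q => //; split=> //; lia.
      have [q' gq' [qq' lq']] := cond_grow gq; exists q' => //; split; last lia.
      exact: extends_trans qp qq'.
    have [q' gq' [qq' lab]] := cond_label gq lq; exists q' => //.
    split; first exact: extends_trans qp qq'.
    by split=> //; have := ext_len qq'; lia.
  - have [[r gr [rp mr]]|no] := pselect (exists2 r, good r & extends r p /\ met a r).
      by exists r => //; split=> //; left.
    exists p => //; split; first exact: extends_refl.
    right; exists p => //; split; first exact: extends_refl.
    by move=> r gr rp mr; apply: no; exists r.
  - by exists p => //; split=> //; exact: extends_refl.
have [g [_ gg gle gD]] := generic_sequence good0 dense.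
have gE m n : m <= n -> extends (g n) (g m).
  move=> /subnK <-; elim: (n - m) => [|k IH]; first exact: extends_refl.
  exact: extends_trans IH (gle _).
have lab l : exists n, l < len (g n) /\ (labA (g n) l \/ labB (g n) l).
  by have := gD (pickle (inl l : nat + name)); rewrite /D pickleK; eexists; eassumption.
pose M x y := exists n, [/\ x < len (g n), y < len (g n) & ord (g n) x y].
have ME n x y : x < len (g n) -> y < len (g n) -> (M x y <-> ord (g n) x y).
  move=> xn yn; split=> [[m [xm ym h]]|h]; last by exists n.
  have h' := gE _ _ (leq_maxl m n); have h'' := gE _ _ (leq_maxr m n).
  by rewrite -(ext_ord h'') // (ext_ord h').
have big l : exists n, l < len (g n) by have [n []] := lab l; exists n.
have lenW m n : m <= n -> len (g m) <= len (g n) by move=> /gE /ext_len.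
have big2 l m : exists2 n, m <= n & l < len (g n).
  have [n ln] := big l; exists (m + n); first exact: leq_addr.
  by apply: leq_trans ln (lenW _ _ _); exact: leq_addl.
have Mle x y : M x y -> x <= y.
  move=> [n [xn yn xy]]; have [->//|/eqP ne] := eqVneq x y.
  by have := good_le (gg n) xy ne; lia.
pose A x := exists n, labA (g n) x; pose B x := exists n, labB (g n) x.
exists M, A, B; split.
- split.
  + move=> x; have [n xn] := big x; rewrite (ME n) //.
    by have [rf _ _] := good_poset (gg n).
  + by move=> x y /Mle h1 /Mle h2; lia.
  + move=> x y z; have [n hn] := big (x + y + z).
    rewrite !(ME n); try lia.
    by have [_ _ tr] := good_poset (gg n); apply: tr.
- by move=> x; have [n [_ [h|h]]] := lab x; [left|right]; exists n.
- move=> x [n Ax] [m Bx]; apply: (good_disj (gg (maxn n m)) (x := x)).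
    by apply: ext_labA Ax; apply: gE; rewrite leq_maxl.
  by apply: ext_labB Bx; apply: gE; rewrite leq_maxr.
- split=> x [n hx]; exists (len (g n)) => y ny.
    have [k nk yk] := big2 y n; rewrite (ME k) //.
      by apply: (ext_A (gE _ _ nk)) => //; lia.
    by have := good_ltA (gg n) hx; lia.
  split; last by move=> /Mle; have := good_ltB (gg n) hx; lia.
  have [k nk yk] := big2 y n; rewrite (ME k) //.
    by apply: (ext_B (gE _ _ nk)) => //; lia.
  by have := good_ltB (gg n) hx; lia.
- move=> a ess; have := gD (pickle (inr a : nat + name)); rewrite /D pickleK.
  set N := _.+1; case=> [[U [V [hU hV [u un h]]]]|[p gp [Np no]]].
    exists U, V; split; first by move=> x /hU; exists N.
      by move=> x /hV; exists N.
    apply: h; apply: agree_oset => x y xu yu; rewrite (ME N) //; lia.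
  (* An essential [a] can be met after all: choose [U] beyond [p] and [V] beyond [U], go to a stage
     containing them and the use, and let [cond_commit] label them. *)
  have [U aU eU] := ess (len p).
  have [m hm] := list_above U.
  have [V aV /sem_open[u hu]] := eU (len p + m).
  have [k hk] := list_above V.
  have [n nN hn] := big2 (m + k + u) N.
  have gnp : extends (g n) p by apply: extends_trans Np (gE _ _ nN).
  have [|||q gq [qp lq oq qU qV]] := cond_commit (m := m) (V := V) gp (gg n) gnp aU.
  + by move=> v /aV; lia.
  + by move=> v /hm; lia.
  + by move=> v vV; have := aV v vV; have := hk v vV; lia.
  case: (no q gq qp); exists U, V; split=> //; exists u; first lia.
  move=> Z hZ; apply: hu; apply: agree_trans hZ; rewrite oq.
  by apply: agree_oset => x y xu yu; rewrite (ME n) //; lia.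
Qed.

(** * The ideal *)

Definition set_rel (L : set nat) : rel nat := fun x y => `[< L (pairc x y) >].

Definition monotone_seq (r : rel nat) (f : nat -> nat) : Prop :=
  (forall n m, n < m -> r (f n) (f m)) \/ (forall n m, n < m -> r (f m) (f n)).

Lemma ads_step A B X L : dep_hyperimmune A B X ->
  exists2 X', dep_hyperimmune A B X' & turing_le X X' /\
    (turing_le L X -> strict_linear (set_rel L) ->
       exists2 f, monotone_seq (set_rel L) f & turing_le (graph f) X').
Proof.
move=> DH.
have [[[c hc] lin]|no] := pselect (turing_le L X /\ strict_linear (set_rel L)); last first.
  exists X => //; split; first exact: turing_le_refl.
  by move=> LX lin; case: no.
have e : query c true X = set_rel L.
  apply/funext => x; apply/funext => y; apply: asbool_equiv_eq.
  rewrite -(chi_eq1 L); split=> [h|<-]; last exact: hc.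
  exact: eval_det (hc _) h.
rewrite -e in lin *; have [f fm fdh] := ads_preservation lin DH.
exists (turing_join X (graph f)) => //; split; first exact: turing_join_l.
by move=> _ _; exists f => //; exact: turing_join_r.
Qed.

(** Bookkeeping: stage [n = pairc i (pickle c)] treats the order that [c] computes from [X i]. Since
    [i <= n], that oracle is already built, and every order computable from some [X i] gets its
    stage. *)
Lemma ads_iterate A B X0 : dep_hyperimmune A B X0 ->
  exists X : nat -> set nat, [/\ X 0 = X0, forall n, dep_hyperimmune A B (X n),
    forall m n, m <= n -> turing_le (X m) (X n) &
    forall i L, turing_le L (X i) -> strict_linear (set_rel L) ->
      exists n, exists2 f, monotone_seq (set_rel L) f & turing_le (graph f) (X n)].
Proof.
move=> DH0.
have /choice[next hnext] : forall XL : set nat * set nat, exists X',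
    dep_hyperimmune A B XL.1 -> [/\ dep_hyperimmune A B X', turing_le XL.1 X' &
    turing_le XL.2 XL.1 -> strict_linear (set_rel XL.2) ->
       exists2 f, monotone_seq (set_rel XL.2) f & turing_le (graph f) X'].
  move=> [X L] /=; have [DH|nDH] := pselect (dep_hyperimmune A B X); last by exists X.
  by have [X' h1 [h2 h3]] := ads_step L DH; exists X'.
(* The history [h] gives access to earlier oracles; the instance collects the inputs on which the
   decoded program outputs 1. *)
pose inst (h : seq (set nat)) n : set nat := fun x =>
  exists i c, n = pairc i (pickle (c : code)) /\ eval (nth X0 h i) c [:: x] 1.
pose hist := fix hist n := if n is m.+1
  then rcons (hist m) (next (last X0 (hist m), inst (hist m) m)) else [:: X0].
have sz n : size (hist n) = n.+1 by elim: n => //= n IH; rewrite size_rcons IH.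
pose X n := last X0 (hist n).
have XS n : X n.+1 = next (X n, inst (hist n) n) by rewrite /X /= last_rcons.
have DH n : dep_hyperimmune A B (X n).
  by elim: n => // n IH; rewrite XS; have [] := hnext (X n, inst (hist n) n) IH.
have up n : turing_le (X n) (X n.+1).
  by rewrite XS; have [] := hnext (X n, inst (hist n) n) (DH n).
have upW m n : m <= n -> turing_le (X m) (X n).
  move=> /subnK <-; elim: (n - m) => [|k IH]; first exact: turing_le_refl.
  exact: turing_le_trans IH (up _).
have nthX i n : i <= n -> nth X0 (hist n) i = X i.
  move=> /subnK <-; elim: (n - i) => [|k IH]; first by rewrite /X -nth_last sz.
  by rewrite addSn /= nth_rcons sz ltnS leq_addl.
exists X; split=> // i L [c hc] lin.
pose n := pairc i (pickle c).
have instE : inst (hist n) n = L.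
  apply/funext => x; apply/propext; rewrite -(chi_eq1 L); split.
    move=> [i' [c' [/pairc_inj[<- /(pcan_inj (@pickleK _)) <-]]]].
    rewrite nthX ?pairc_gel // => h; exact: eval_det (hc x) h.
  by move=> h; exists i, c; rewrite nthX ?pairc_gel // -h.
exists n.+1; have [_ _] := hnext (X n, inst (hist n) n) (DH n).
rewrite -XS /= instE; apply=> //.
by apply: (turing_le_trans (Y := X i)); [exists c|apply: upW; exact: pairc_gel].
Qed.

Lemma chain_ideal (X : nat -> set nat) :
  (forall m n, m <= n -> turing_le (X m) (X n)) ->
  turing_ideal (fun Z => exists n, turing_le Z (X n)).
Proof.
move=> up; split.
- by exists (X 0), 0; exact: turing_le_refl.
- by move=> Z Y [n Yn] ZY; exists n; exact: turing_le_trans ZY Yn.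
- move=> Y Z [n Yn] [m Zm]; exists (maxn n m); apply: turing_join_le.
    by apply: turing_le_trans Yn (up _ _ _); exact: leq_maxl.
  by apply: turing_le_trans Zm (up _ _ _); exact: leq_maxr.
Qed.

(** For an infinite [C] inside [A], the relation saying that [V] meets [C] is essential, so it holds
    of some [V] inside [B], against disjointness. *)
Lemma dep_hyperimmune_A A B X C : (forall x, A x -> ~ B x) ->
  dep_hyperimmune A B X -> turing_le C X -> unbounded C ->
  exists2 x, C x & ~ A x.
Proof.
move=> dis DH [c hc] inf; apply: contrapT => h.
have CA x : C x -> A x by move=> Cx; apply: contrapT => nA; apply: h; exists x.
have [|U [V [_ VB [z zV ez]]]] := DH (OnV c).
  move=> x; exists [::] => // y; have [n yn Cn] := inf y.+1.
  exists [:: n] => [z|]; first by rewrite inE => /eqP ->.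
  by exists n; rewrite ?mem_head // -(chi1 Cn).
apply: (dis z (CA _ _) (VB _ zV)).
by rewrite -(chi_eq1 C) (eval_det (hc z) ez).
Qed.

Lemma dep_hyperimmune_B A B X C : (forall x, A x -> ~ B x) ->
  dep_hyperimmune A B X -> turing_le C X -> unbounded C ->
  exists2 x, C x & ~ B x.
Proof.
move=> dis DH [c hc] inf; apply: contrapT => h.
have CB x : C x -> B x by move=> Cx; apply: contrapT => nB; apply: h; exists x.
have [|U [V [UA _ [z zU ez]]]] := DH (OnU c).
  move=> x; have [n yn Cn] := inf x.+1.
  exists [:: n] => [z|y]; first by rewrite inE => /eqP ->.
  by exists [::] => //; exists n; rewrite ?mem_head // -(chi1 Cn).
apply: (dis z (UA _ zU) (CB _ _)).
by rewrite -(chi_eq1 C) (eval_det (hc z) ez).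
Qed.

(** * Soundness of [RCA0] in Turing ideals *)

Lemma teval_subst e s t : teval e (tsubst s t) = teval (fun i => teval e (s i)) t.
Proof. by elim: t => //= t -> u ->. Qed.

Lemma teval_shift n e t : teval (scons n e) (tshift t) = teval e t.
Proof. by rewrite /tshift teval_subst. Qed.

Lemma teval_scons n e s :
  (fun i => teval (scons n e) (scons (Var 0) (fun i => tshift (s i)) i)) =
  scons n (fun i => teval e (s i)).
Proof. by apply/funext => -[|i] //=; rewrite teval_shift. Qed.

Lemma scons_set (X : set nat) E r :
  (fun i => scons X E (scons 0 (fun i => (r i).+1) i)) = scons X (fun i => E (r i)).
Proof. by apply/funext => -[|i]. Qed.

Lemma sat_subst I p : forall e E s r,
  sat I e E (subst s r p) = sat I (fun i => teval e (s i)) (fun i => E (r i)) p.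
Proof.
elim: p => [|t u|t u|t X|p IHp q IHq|p IHp q IHq|p IHp q IHq|p IH|p IH|p IH|p IH] e E s r //=;
  rewrite ?teval_subst ?IHp ?IHq //.
- by apply: eq_forall => n; rewrite IH teval_scons.
- by apply: eq_exists => n; rewrite IH teval_scons.
- by apply: eq_forall => X; rewrite IH scons_set.
- by apply/propext; split=> -[X IX h]; exists X; move: h; rewrite // IH scons_set.
Qed.

Lemma sat_shiftN I n e E p : sat I (scons n e) E (shiftN p) = sat I e E p.
Proof. exact: sat_subst. Qed.

Lemma sat_shiftS I X e E p : sat I e (scons X E) (shiftS p) = sat I e E p.
Proof. exact: sat_subst. Qed.

Lemma sat_instN I e E t p : sat I e E (instN t p) = sat I (scons (teval e t) e) E p.
Proof.
rewrite /instN sat_subst; congr (sat _ _ _ _).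
by apply/funext => -[|i].
Qed.

Lemma sat_instS I e E X p : sat I e E (instS X p) = sat I e (scons (E X) E) p.
Proof.
rewrite /instS sat_subst; congr (sat _ _ _ _).
by apply/funext => -[|i].
Qed.

Lemma In_map (f : form -> form) q G : List.In q (map f G) -> exists2 p, List.In p G & q = f p.
Proof.
elim: G => //= p G IH [<-|/IH[p' h ->]]; first by exists p; [left|].
by exists p'; [right|].
Qed.

(** Axioms hold under every assignment into [I], which is why they need no shift under
    quantifiers. *)
Lemma soundness (I : set (set nat)) T G p : (forall q, T q -> omega_sat I q) ->
  proves T G p -> forall e E, (forall i, I (E i)) ->
  (forall q, List.In q G -> sat I e E q) -> sat I e E p.
Proof.
move=> hT; elim=> {G p}.
- by move=> G p /hT h e E hE _; apply: h.
- by move=> G p pG e E hE hG; apply: hG.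
- move=> G p _ IH e E hE hG; apply: contrapT => np.
  by apply: (IH e E hE) => q /= [<-//|/hG].
- move=> G p q _ IH e E hE hG /= hp; apply: (IH e E hE) => r /= [<-//|/hG//].
- by move=> G p q _ IH1 _ IH2 e E hE hG; apply: (IH1 e E hE hG); apply: IH2.
- by move=> G p q _ IH1 _ IH2 e E hE hG; split; [apply: IH1|apply: IH2].
- by move=> G p q _ IH e E hE hG; case: (IH e E hE hG).
- by move=> G p q _ IH e E hE hG; case: (IH e E hE hG).
- by move=> G p q _ IH e E hE hG; left; apply: IH.
- by move=> G p q _ IH e E hE hG; right; apply: IH.
- move=> G p q c _ IH1 _ IH2 _ IH3 e E hE hG; case: (IH1 e E hE hG) => h.
    by apply: (IH2 e E hE) => r /= [<-//|/hG].
  by apply: (IH3 e E hE) => r /= [<-//|/hG].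
- move=> G p _ IH e E hE hG n; apply: IH => // q /In_map[q' /hG h ->].
  by rewrite sat_shiftN.
- by move=> G p t _ IH e E hE hG; rewrite sat_instN; apply: (IH e E hE hG).
- by move=> G p t _ IH e E hE hG; exists (teval e t); rewrite -sat_instN; apply: IH.
- move=> G p c _ IH1 _ IH2 e E hE hG; have [n hn] := IH1 e E hE hG.
  rewrite -(sat_shiftN I n); apply: IH2 => // q /= [<-//|/In_map[q' /hG h ->]].
  by rewrite sat_shiftN.
- move=> G p _ IH e E hE hG X IX; apply: IH; first by case.
  by move=> q /In_map[q' /hG h ->]; rewrite sat_shiftS.
- by move=> G p X _ IH e E hE hG; rewrite sat_instS; apply: (IH e E hE hG).
- by move=> G p X _ IH e E hE hG; exists (E X) => //; rewrite -sat_instS; apply: IH.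
- move=> G p c _ IH1 _ IH2 e E hE hG; have [X IX hX] := IH1 e E hE hG.
  rewrite -(sat_shiftS I X); apply: IH2; first by case.
  by move=> q /= [<-//|/In_map[q' /hG h ->]]; rewrite sat_shiftS.
- by [].
- move=> G t u p _ IH1 _ IH2 e E hE hG; have := IH2 e E hE hG.
  by rewrite !sat_instN; have /= -> := IH1 e E hE hG.
Qed.

Definition env (v : seq nat) (e : nat -> nat) (i : nat) : nat :=
  if i < size v then nth 0 v i else e (i - size v).

Lemma env_scons n v e : scons n (env v e) = env (n :: v) e.
Proof. by apply/funext => -[|i]. Qed.

Lemma rec_term Y k e t : rec Y k (fun v => teval (env v e) t).
Proof.
elim: t => [i| | |t IHt u IHu|t IHt u IHu] /=; try exact: rec_const.
- have [ik|ki] := ltnP i k.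
    by apply: rec_ext (rec_proj Y ik) => v sv; rewrite /env sv ik.
  by apply: rec_ext (rec_const Y k (e (i - k))) => v sv; rewrite /env sv ltnNge ki.
- exact: recD.
- exact: recM.
Qed.

Section Ideal.
Variables (I : set (set nat)) (E : nat -> set nat).
Hypotheses (idI : turing_ideal I) (IE : forall i, I (E i)).

Definition decidesI (k : nat) (P : seq nat -> Prop) : Prop :=
  exists2 Y, I Y & decides Y k P.

Lemma decidesI_common k k' P Q : decidesI k P -> decidesI k' Q ->
  exists2 Y, I Y & decides Y k P /\ decides Y k' Q.
Proof.
move=> [Y IY hP] [Z IZ hQ]; exists (turing_join Y Z); first by case: idI => _ _; apply.
by split; [apply: rec_le hP; exact: turing_join_l|apply: rec_le hQ; exact: turing_join_r].
Qed.

Lemma decidesI_now Y k P : I Y -> decides Y k P -> decidesI k P.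
Proof. by exists Y. Qed.

(** Atomic formulas consult different sets of [I]; joins merge them into one oracle, and bounded
    quantifiers become bounded searches. *)
Lemma decidesI_bounded q : bounded q ->
  forall k e, decidesI k (fun v => sat I (env v e) E q).
Proof.
elim=> {q} /=.
- move=> k e; apply: (decidesI_now (IE 0)).
  by apply: decides_ext (decides_eq0 (rec_const (E 0) k 1)).
- by move=> t u k e; apply: (decidesI_now (IE 0)); apply: decides_eq; exact: rec_term.
- by move=> t u k e; apply: (decidesI_now (IE 0)); apply: decides_lt; exact: rec_term.
- move=> t X k e; apply: (decidesI_now (IE X)).
  exact: (rec_comp1 (chi_decides (turing_le_refl (E X))) (rec_term _ _ _ _)).
- move=> p q _ IHp _ IHq k e; have [Y IY [hp hq]] := decidesI_common (IHp k e) (IHq k e).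
  by exists Y => //; apply: decides_imp.
- move=> p q _ IHp _ IHq k e; have [Y IY [hp hq]] := decidesI_common (IHp k e) (IHq k e).
  by exists Y => //; apply: decides_and.
- move=> p q _ IHp _ IHq k e; have [Y IY [hp hq]] := decidesI_common (IHp k e) (IHq k e).
  by exists Y => //; apply: decides_or.
- move=> t p _ IH k e; have [Y IY hp] := IH k.+1 e; exists Y => //.
  apply: decides_ext (decides_all hp (rec_term Y k e t)) => v sv.
  by split=> h n; have := h n; rewrite ?teval_shift -env_scons.
- move=> t p _ IH k e; have [Y IY hp] := IH k.+1 e; exists Y => //.
  apply: decides_ext (decides_not (decides_all (decides_not hp) (rec_term Y k e t))) => v sv.
  split=> [h|[n [nt hn]] h].
    apply: contrapT => no; apply: h => n nt hn; apply: no; exists n.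
    by rewrite teval_shift env_scons.
  by apply: (h n); rewrite -?env_scons //; move: nt; rewrite teval_shift.
Qed.

(** For each [n] there is a witness for [p] or a counterexample to [q]. An unbounded search finds
    such an [m], and [p] holds at [n] exactly when [m] is a witness. *)
Lemma comprehension (e : nat -> nat) p q : Sigma01 p -> Pi01 q ->
  (forall n, sat I (scons n e) E p <-> sat I (scons n e) E q) ->
  I (fun n => sat I (scons n e) E p).
Proof.
move=> [p' bp ->] [q' bq ->] /= pq.
have [Y IY [hp hq]] := decidesI_common (decidesI_bounded bp 2 e) (decidesI_bounded bq 2 e).
have envE m n : env [:: m; n] e = scons m (scons n e).
  by rewrite -!env_scons; congr scons; congr scons; apply/funext => i; rewrite /env subn0.
have [|f rf hf] := rec_mu (decides_or hp (decides_not hq)).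
  move=> v /seq1 ->; apply: contrapT => no.
  have no' m : ~ sat I (scons m (scons (nth 0 v 0) e)) E p' /\
      sat I (scons m (scons (nth 0 v 0) e)) E q'.
    by rewrite -envE; split=> [h|]; [|apply: contrapT => h]; apply: no; exists m; [left|right].
  have [m] : exists m, sat I (scons m (scons (nth 0 v 0) e)) E p'.
    by apply/pq => m; have [] := no' m.
  by have [] := no' m.
have [_ down _] := idI; apply: (down _ Y IY); apply: turing_le_decides.
apply: decides_ext (rec_cons hp rf) => v sv.
have := hf v sv; rewrite (seq1 sv) /= !envE; set n := nth 0 v 0; set m := f _.
move=> h; split=> [h'|/pq h']; first by exists m.
by case: h => // h; case: h.
Qed.
End Ideal.

(** The numbers are standard, so arithmetic and induction hold outright; comprehension is where the
    closure of the ideal enters. *)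
Lemma RCA0_sound I p : turing_ideal I -> RCA0 p -> omega_sat I p.
Proof.
move=> idI; case=> {p} /=; try by move=> e E _ /=; lia.
- move=> p _ e E hE /= [h0 hS]; elim=> [|n IH].
    by move: h0; rewrite sat_instN.
  have := hS n IH; rewrite sat_subst; congr sat.
  by apply/funext => -[|i] //=; rewrite addn1.
- move=> p q hp hq e E hE /= pq.
  exists (fun n => sat I (scons n e) E p).
    by apply: comprehension hp hq _ => // n; have [] := pq n.
  by move=> n; rewrite sat_shiftS.
Qed.

(** * The separation *)

Lemma omega_sat_ADS (I : set (set nat)) :
  (forall L, I L -> strict_linear (set_rel L) ->
     exists2 f, monotone_seq (set_rel L) f & I (graph f)) ->
  omega_sat I ADS.
Proof.
move=> h e E hE L IL /= [irr [tr tot]].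
have [|f mono If] := h L IL.
  split.
  - by move=> x; apply/asboolPn; exact: irr.
  (* The outermost quantifier binds the highest index, hence the reversed order of the arguments of
     [tr]. *)
  - by move=> y x z /asboolP xy /asboolP yz; apply/asboolP; exact: (tr z y x (conj xy yz)).
  - move=> x y ne; case: (tot y x) => [//|[h'|h']]; [left|right]; exact/asboolP.
exists (graph f) => //; split.
  split; first by move=> n; exists (f n); exists n.
  by move=> z y x [[n /pairc_inj[ex ->]] [m /pairc_inj[ex' ->]]]; rewrite -ex -ex'.
have mono' : (forall n m, n < m -> L (pairc (f n) (f m))) \/
    (forall n m, n < m -> L (pairc (f m) (f n))).
  by case: mono => mono; [left|right] => n m /mono /asboolP.
by case: mono' => mono'; [left|right] => b a m n [nm
  [[n' /pairc_inj[<- ->]] [m' /pairc_inj[<- ->]]]]; exact: mono'.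
Qed.

(** Any infinite set in [I] contains an element of [B] and one of [A]. The former is incomparable
    with almost all numbers, which excludes a chain; the latter is below almost all, which excludes
    an antichain. *)
Lemma not_omega_sat_SCAC (I : set (set nat)) M (A B : set nat) :
  poset M -> I (oset M) -> (forall x, A x \/ B x) ->
  (forall x, A x -> exists m, forall y, m < y -> M x y) ->
  (forall x, B x -> exists m, forall y, m < y -> ~ M x y /\ ~ M y x) ->
  (forall C, I C -> unbounded C -> exists2 x, C x & ~ A x) ->
  (forall C, I C -> unbounded C -> exists2 x, C x & ~ B x) ->
  ~ omega_sat I SCAC.
Proof.
move=> [rf an tr] IM AB hA hB noA noB /(_ (fun=> 0) (fun=> oset M) (fun=> IM)) /=.
have inc x y : ~ M x y /\ ~ M y x <-> (~ oset M (pairc x y) /\ ~ oset M (pairc y x)).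
  by rewrite !osetE.
case/(_ (oset M) IM) => [|S IS [inf cac]].
  split; first split; first by move=> x; apply/osetE.
    split; first by move=> y x [/osetE xy /osetE yx]; apply: an.
    by move=> z y x [/osetE xy /osetE yz]; apply/osetE; apply: tr xy yz.
  left=> x; have [/hA|/hB] := AB x; move=> [m hm]; [left|right]; exists m => y my.
    by apply/osetE; exact: hm.
  by apply/inc; exact: hm.
have infS : unbounded S.
  by move=> m; have [n [mn Sn]] := inf m; exists n => //; exact: ltnW.
case: cac => hS.
  have [x Sx nA] := noA S IS infS; have [//|/hB[m hm]] := AB x.
  have [n [mn Sn]] := inf m; have [n1 n2] := hm n mn.
  by case: (hS n x (conj Sx Sn)) => /osetE.
have [x Sx nB] := noB S IS infS; have [/hA[m hm]|//] := AB x.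
(* Beyond [x + m] the number [n] exceeds the bound [m] and differs from [x]. *)
have [n [mn Sn]] := inf (x + m).
case: (hS n x) => [|h _]; last by apply: h; apply/osetE; apply: hm; lia.
by do 2!split=> //; rewrite /=; lia.
Qed.

Theorem theorem1p7 :
  (exists I : set (set nat),
      [/\ turing_ideal I, omega_sat I ADS & ~ omega_sat I SCAC]) /\
  ~ proves RCA0 [::] (ADS -> SCAC)%L2.
Proof.
have [I [idI ads nscac]] : exists I : set (set nat),
    [/\ turing_ideal I, omega_sat I ADS & ~ omega_sat I SCAC].
  have [M [A [B [pM AB dis [hA hB] DH]]]] := ground_poset.
  have [X [X0 DHX up sol]] := ads_iterate DH.
  exists (fun Z => exists n, turing_le Z (X n)); split.
  - exact: chain_ideal.
  - apply: omega_sat_ADS => L [i Li] lin.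
    by have [n [f mf fn]] := sol i L Li lin; exists f => //; exists n.
  - apply: (not_omega_sat_SCAC pM _ AB hA hB) => [|C [n Cn] inf|C [n Cn] inf].
    + by exists 0; rewrite X0; exact: turing_le_refl.
    + exact: dep_hyperimmune_A dis (DHX n) Cn inf.
    + exact: dep_hyperimmune_B dis (DHX n) Cn inf.
split; first by exists I.
(* By soundness a derivation would transfer the truth of ADS in the model to SCAC. *)
move=> pf; apply: nscac => e E hE.
have := soundness (fun q => @RCA0_sound I q idI) pf (e := e) hE.
by apply=> //; exact: ads.
Qed.
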